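(* Let $X_0,X_1$ be two Banach function spaces on $I=[0,\infty)$. If $C$ and $C^*$ are bounded on $X_i$ for $i=0,1$ and $F$ is an interpolation functor with the homogeneity property, that is, $F(X_0(w),X_1(w))=F(X_0,X_1)(w)$ for any weight $w$ on $I$, then $$F(CX_0,CX_1)=CF(X_0,X_1).$$ In particular, $$(CX_0,CX_1)_G^K=C[(X_0,X_1)_G^K].$$
   Context: Let $I=[0,\infty)$ with Lebesgue measure, and let $L^0$ be the set of equivalence classes of real-valued measurable functions on $I$. A Banach function space (Banach ideal space on $I$) is a Banach space $X\subset L^0$ such that $f,g\in L^0$, $|f|\le|g|$ a.e., $g\in X$ imply $f\in X$ and $\|f\|_X\le\|g\|_X$; it is assumed to contain some $f$ with $f(x)>0$ for each $x\in I$. A weight is a measurable $w$ with $0<w(x)<\infty$ a.e., and $X(w)=\{f\in L^0:fw\in X\}$ with $\|f\|_{X(w)}=\|fw\|_X$. $X=Y$ means the spaces coincide as sets with equivalent norms. $Cf(x)=\frac1x\int_0^xf(t)\,dt$, $C^*f(x)=\int_x^\infty\frac{f(t)}{t}\,dt$, and $CX=\{f\in L^0:C|f|\in X\}$ with $\|f\|_{CX}=\|C|f|\|_X$. An interpolation functor $F$ assigns to each Banach couple $(Y_0,Y_1)$ a Banach space $F(Y_0,Y_1)$ with $Y_0\cap Y_1\hookrightarrow F(Y_0,Y_1)\hookrightarrow Y_0+Y_1$, such that any linear operator $T:Y_0+Y_1\to Z_0+Z_1$ which is bounded $Y_i\to Z_i$ for $i=0,1$ is bounded $F(Y_0,Y_1)\to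 F(Z_0,Z_1)$. For a Banach couple $(Y_0,Y_1)$ and $f\in Y_0+Y_1$, $K(t,f;Y_0,Y_1)=\inf\{\|f_0\|_{Y_0}+t\|f_1\|_{Y_1}:f=f_0+f_1,\ f_i\in Y_i\}$, $t>0$. $G$ is any Banach ideal space on $(0,\infty)$ containing the function $\min(1,t)$, and $(Y_0,Y_1)_G^K=\{f\in Y_0+Y_1:K(\cdot,f;Y_0,Y_1)\in G\}$ with norm $\|K(\cdot,f;Y_0,Y_1)\|_G$. *)

(* Defs.v *)
From HB Require Import structures.
From mathcomp Require Import all_boot all_order all_algebra.
From mathcomp Require Import all_classical all_reals all_analysis.
From mathcomp Require Import measurable_realfun.

Set Implicit Arguments.
Unset Strict Implicit.
Unset Printing Implicit Defensive.

Import Order.TTheory GRing.Theory Num.Theory.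
Import numFieldNormedType.Exports.

Local Open Scope classical_set_scope.
Local Open Scope ring_scope.

(* A linear subspace of V with its own norm. Only the values of [nrm] on [dom]
   are meaningful. *)
Record nspace (R : realType) (V : lmodType R) := NSpace {
  dom : set V;
  nrm : V -> R }.

Section NormedSubspaces.
Context {R : realType} {V : lmodType R}.
Implicit Types X Y : nspace V.

Record is_banach X : Prop := IsBanach {
  banach_dom0 : dom X 0;
  banach_domP : forall (a : R) x y, dom X x -> dom X y -> dom X (a *: x + y);
  banach_ge0 : forall x, dom X x -> 0 <= nrm X x;
  banach_eq0 : forall x, dom X x -> nrm X x = 0 -> x = 0;
  banach_nrmZ : forall (a : R) x, dom X x -> nrm X (a *: x) = `|a| * nrm X x;
  banach_nrmD : forall x y, dom X x -> dom X y ->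
    nrm X (x + y) <= nrm X x + nrm X y;
  banach_complete : forall u : nat -> V, (forall n, dom X (u n)) ->
    (forall e : R, 0 < e -> exists N : nat, forall m n : nat,
       (N <= m)%N -> (N <= n)%N -> nrm X (u m - u n) < e) ->
    exists2 x, dom X x & (fun n => nrm X (u n - x)) @ \oo --> (0 : R) }.

Definition Kfun (Y0 Y1 : nspace V) (t : R) (x : V) : R :=
  inf [set r | exists x0 x1, [/\ dom Y0 x0, dom Y1 x1, x = x0 + x1
                              & r = nrm Y0 x0 + t * nrm Y1 x1]].

Definition nsum (Y0 Y1 : nspace V) : nspace V :=
  NSpace [set x | exists x0 x1, [/\ dom Y0 x0, dom Y1 x1 & x = x0 + x1]]
         (Kfun Y0 Y1 1).

Definition ninter (Y0 Y1 : nspace V) : nspace V :=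
  NSpace (dom Y0 `&` dom Y1) (fun x => Num.max (nrm Y0 x) (nrm Y1 x)).

End NormedSubspaces.

Definition linear_on (R : realType) (V W : lmodType R) (D : set V)
    (T : V -> W) : Prop :=
  forall (a : R) x y, D x -> D y -> T (a *: x + y) = a *: T x + T y.

Definition bounded_op (R : realType) (V W : lmodType R) (Y : nspace V)
    (Z : nspace W) (T : V -> W) : Prop :=
  exists M : R, forall x, dom Y x ->
    dom Z (T x) /\ nrm Z (T x) <= M * nrm Y x.

Definition embeds (R : realType) (V : lmodType R) (X Y : nspace V) : Prop :=
  bounded_op X Y id.

Definition nequiv (R : realType) (V : lmodType R) (X Y : nspace V) : Prop :=
  dom X = dom Y /\
  exists c : R, forall x, dom X x ->
    nrm X x <= c * nrm Y x /\ nrm Y x <= c * nrm X x.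

(* Two Banach spaces continuously embedded in a common Hausdorff topological
   vector space W. V serves only to form sums and intersections; it carries no
   topology, and j is relevant only on Y0 + Y1. Continuity of the linear map j
   on Y0 and on Y1 is expressed at the origin. *)
Definition banach_couple (R : realType) (V : lmodType R) (Y0 Y1 : nspace V)
    : Prop :=
  [/\ is_banach Y0, is_banach Y1 &
    exists (W : topologicalLmodType R) (j : V -> W),
      [/\ hausdorff_space W,
          linear_on (dom (nsum Y0 Y1)) j,
          {in dom (nsum Y0 Y1) &, injective j},
          (forall U : set W, nbhs 0 U -> exists2 e : R, 0 < e &
             forall x, dom Y0 x -> nrm Y0 x < e -> U (j x)) &
          (forall U : set W, nbhs 0 U -> exists2 e : R, 0 < e &
             forall x, dom Y1 x -> nrm Y1 x < e -> U (j x))]].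

(* The value of a functor on a pair that is not a Banach couple is
   irrelevant. *)
Definition couple_map (R : realType) :=
  forall V : lmodType R, nspace V -> nspace V -> nspace V.

Record interpolation_functor (R : realType) (F : couple_map R) : Prop :=
  InterpolationFunctor {
  interp_banach : forall (V : lmodType R) (Y0 Y1 : nspace V),
    banach_couple Y0 Y1 -> is_banach (F V Y0 Y1);
  interp_inter : forall (V : lmodType R) (Y0 Y1 : nspace V),
    banach_couple Y0 Y1 -> embeds (ninter Y0 Y1) (F V Y0 Y1);
  interp_sum : forall (V : lmodType R) (Y0 Y1 : nspace V),
    banach_couple Y0 Y1 -> embeds (F V Y0 Y1) (nsum Y0 Y1);
  interp_op : forall (V W : lmodType R) (Y0 Y1 : nspace V) (Z0 Z1 : nspace W)
      (T : V -> W),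
    banach_couple Y0 Y1 -> banach_couple Z0 Z1 ->
    linear_on (dom (nsum Y0 Y1)) T ->
    bounded_op Y0 Z0 T -> bounded_op Y1 Z1 T ->
    bounded_op (F V Y0 Y1) (F W Z0 Z1) T }.

Definition halfline (R : realType) : set (measurableTypeR R) := `[0, +oo[.

Lemma measurable_halfline (R : realType) : measurable (@halfline R).
Proof. exact: measurable_itv. Qed.

(* Values outside the half-line are not seen by this measure. *)
Definition lebI (R : realType) : {measure set (measurableTypeR R) -> \bar R} :=
  mrestr (@lebesgue_measure R) (@measurable_halfline R).

Definition L0 (R : realType) : Type :=
  {mfun_ (@lebI R), (measurableTypeR R) >-> R}.

Section L0_lmodule.
Context {R : realType}.
Local Open Scope quotient_scope.
Local Notation T := (measurableTypeR R).
Implicit Types f g : L0 R.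

HB.instance Definition _ := Choice.on (L0 R).
HB.instance Definition _ := EqQuotient.on (L0 R).

(* A representative; values are meaningful only a.e. on the half-line. *)
Definition L0_fun f : T -> R := repr f.
Coercion L0_fun : L0 >-> Funclass.

Definition L0_class (f : {mfun T >-> R}) : L0 R := \pi_(L0 R) f.

Lemma L0_classP (f g : {mfun T >-> R}) :
  L0_class f = L0_class g <-> {ae @lebI R, forall x, f x = g x}.
Proof.
rewrite /L0_class; split.
  by move=> /eqmodP/asboolP; apply: filterS => x; apply.
by move=> fg; apply/eqmodP/asboolP; apply: filterS fg => x.
Qed.

Lemma L0_classE (f : {mfun T >-> R}) :
  {ae @lebI R, forall x, L0_class f x = f x}.
Proof. by apply/L0_classP; rewrite /L0_class reprK. Qed.

Lemma L0P f g : f = g <-> {ae @lebI R, forall x, f x = g x}.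
Proof.
by rewrite -(L0_classP (repr f) (repr g)) /L0_class !reprK.
Qed.

Definition L0_add f g : L0 R := L0_class (repr f + repr g).
Definition L0_opp f : L0 R := L0_class (- repr f).
Definition L0_zero : L0 R := L0_class 0.
Definition L0_scale (a : R) f : L0 R := L0_class (a *: (repr f : {mfun T >-> R})).
Definition L0_mul f g : L0 R := L0_class (repr f * repr g).

Lemma L0_addE f g : {ae @lebI R, forall x, L0_add f g x = f x + g x}.
Proof. by have := L0_classE (repr f + repr g). Qed.
Lemma L0_oppE f : {ae @lebI R, forall x, L0_opp f x = - f x}.
Proof. by have := L0_classE (- repr f). Qed.
Lemma L0_zeroE : {ae @lebI R, forall x, L0_zero x = 0}.
Proof. by have := L0_classE 0. Qed.
Lemma L0_scaleE (a : R) f : {ae @lebI R, forall x, L0_scale a f x = a * f x}.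
Proof. by have := L0_classE (a *: (repr f : {mfun T >-> R})). Qed.
Lemma L0_mulE f g : {ae @lebI R, forall x, L0_mul f g x = f x * g x}.
Proof. by have := L0_classE (repr f * repr g). Qed.

Lemma L0_addA : associative L0_add.
Proof.
move=> f g h; apply/L0P.
apply: filterS (filterI (filterI (L0_addE f (L0_add g h)) (L0_addE g h))
  (filterI (L0_addE (L0_add f g) h) (L0_addE f g))) => x.
by move=> [[-> ->] [-> ->]]; rewrite addrA.
Qed.

Lemma L0_addC : commutative L0_add.
Proof.
move=> f g; apply/L0P.
apply: filterS (filterI (L0_addE f g) (L0_addE g f)) => x.
by move=> [-> ->]; rewrite addrC.
Qed.

Lemma L0_add0 : left_id L0_zero L0_add.
Proof.
move=> f; apply/L0P.
apply: filterS (filterI (L0_addE L0_zero f) L0_zeroE) => x.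
by move=> [-> ->]; rewrite add0r.
Qed.

Lemma L0_addN : left_inverse L0_zero L0_opp L0_add.
Proof.
move=> f; apply/L0P.
apply: filterS (filterI (filterI (L0_addE (L0_opp f) f) (L0_oppE f))
  L0_zeroE) => x.
by move=> [[-> ->] ->]; rewrite addNr.
Qed.

HB.instance Definition _ :=
  GRing.isZmodule.Build (L0 R) L0_addA L0_addC L0_add0 L0_addN.

Lemma L0_scaleA (a b : R) f : L0_scale a (L0_scale b f) = L0_scale (a * b) f.
Proof.
apply/L0P.
apply: filterS (filterI (filterI (L0_scaleE a (L0_scale b f)) (L0_scaleE b f))
  (L0_scaleE (a * b) f)) => x.
by move=> [[-> ->] ->]; rewrite mulrA.
Qed.

Lemma L0_scale1 : left_id 1 L0_scale.
Proof.
by move=> f; apply/L0P; apply: filterS (L0_scaleE 1 f) => x ->; rewrite mul1r.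
Qed.

Lemma L0_scaleDr : right_distributive L0_scale +%R.
Proof.
move=> a f g; apply/L0P.
apply: filterS (filterI (filterI (L0_scaleE a (f + g)) (L0_addE f g))
  (filterI (L0_addE (L0_scale a f) (L0_scale a g))
           (filterI (L0_scaleE a f) (L0_scaleE a g)))) => x.
by move=> [[-> ->] [-> [-> ->]]]; rewrite mulrDr.
Qed.

Lemma L0_scaleDl f : {morph L0_scale^~ f : a b / a + b}.
Proof.
move=> a b; apply/L0P.
apply: filterS (filterI (L0_scaleE (a + b) f)
  (filterI (L0_addE (L0_scale a f) (L0_scale b f))
           (filterI (L0_scaleE a f) (L0_scaleE b f)))) => x.
by move=> [-> [-> [-> ->]]]; rewrite mulrDl.
Qed.

HB.instance Definition _ := GRing.Zmodule_isLmodule.Build R (L0 R)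
  L0_scaleA L0_scale1 L0_scaleDr L0_scaleDl.

End L0_lmodule.

Section BanachFunctionSpaces.
Context {R : realType}.
Local Notation T := (measurableTypeR R).
Local Notation leb := (@lebesgue_measure R).
Implicit Types (X G : nspace (L0 R)) (f g : L0 R).

(* g is the class of h; forces h to be finite a.e. on the half-line. *)
Definition represents (h : T -> \bar R) (g : L0 R) : Prop :=
  {ae @lebI R, forall x, (g x)%:E = h x}.

Record banach_ideal X : Prop := BanachIdeal {
  ideal_banach : is_banach X;
  ideal_solid : forall f g, {ae @lebI R, forall x, `|f x| <= `|g x|} ->
    dom X g -> dom X f /\ nrm X f <= nrm X g }.

Record banach_function_space X : Prop := BanachFunctionSpace {
  bfs_ideal : banach_ideal X;
  bfs_pos : exists f : {mfun T >-> R},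
    (forall x, halfline x -> 0 < f x) /\ dom X (L0_class f) }.

Definition weight (w : L0 R) : Prop := {ae @lebI R, forall x, 0 < w x}.

Definition weighted X (w : L0 R) : nspace (L0 R) :=
  NSpace [set f | dom X (L0_mul f w)] (fun f => nrm X (L0_mul f w)).

Definition cesaro (f : T -> R) (x : T) : \bar R :=
  (x^-1)%:E * \int[leb]_(t in `[0%R, x]) (f t)%:E.

Definition copson (f : T -> R) (x : T) : \bar R :=
  \int[leb]_(t in `[x, +oo[) (f t / t)%:E.

(* The integrals defining C f and C^* f are required to converge absolutely. *)
Definition is_cesaro (f : T -> R) (g : L0 R) : Prop :=
  {ae @lebI R, forall x, leb.-integrable `[0%R, x] (EFin \o f)} /\
  represents (cesaro f) g.

Definition is_copson (f : T -> R) (g : L0 R) : Prop :=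
  {ae @lebI R, forall x, leb.-integrable `[x, +oo[ (fun t => (f t / t)%:E)} /\
  represents (copson f) g.

(* The operator is given by its graph, since it need not be defined on L^0. *)
Definition bounded_on X (graph : (T -> R) -> L0 R -> Prop) : Prop :=
  exists M : R, forall f, dom X f ->
    exists g, [/\ graph f g, dom X g & nrm X g <= M * nrm X f].

Definition absf (f : L0 R) : T -> R := fun t => `|f t|.

(* CX. The class C|f| is unique when it exists; 0 is only the default of the
   choice operator and is not used on the domain. *)
Definition CX X : nspace (L0 R) :=
  NSpace [set f | exists2 g, is_cesaro (absf f) g & dom X g]
         (fun f => nrm X (xget 0 (is_cesaro (absf f)))).

Definition homogeneous_on (F : couple_map R) X0 X1 : Prop :=
  forall w : L0 R, weight w ->
    nequiv (F _ (weighted X0 w) (weighted X1 w)) (weighted (F _ X0 X1) w).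

(* A Banach ideal space on (0, oo) is a subspace of L^0 of the half-line,
   since {0} is a null set. *)
Definition Kmethod G (V : lmodType R) (Y0 Y1 : nspace V) : nspace V :=
  NSpace [set y | dom (nsum Y0 Y1) y /\
            exists2 k, represents (fun t => (Kfun Y0 Y1 t y)%:E) k & dom G k]
         (fun y => nrm G (xget 0 (represents (fun t => (Kfun Y0 Y1 t y)%:E)))).

Definition contains_min1 G : Prop :=
  exists2 m, represents (fun t : T => (Num.min 1 (t : R))%:E) m & dom G m.

End BanachFunctionSpaces.

(* Main.v *)
Require Import Defs.
From HB Require Import structures.
From mathcomp Require Import all_boot all_order all_algebra.
From mathcomp Require Import all_classical all_reals all_analysis.
From mathcomp Require Import measurable_realfun lra ring.

Set Implicit Arguments.
Unset Strict Implicit.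
Unset Printing Implicit Defensive.

Import Order.TTheory GRing.Theory Num.Theory.
Import numFieldNormedType.Exports.

Local Open Scope classical_set_scope.
Local Open Scope ring_scope.

(** The theorem holds because f and C|f| are exchanged by linear operators whose
    norms do not depend on f.

    From f to C|f|: the operator u |-> C(sgn(f) u) is linear, maps CX into X
    with norm at most 1 for every Banach ideal space X, and sends f to C|f|
    ([signed_average]).

    From C|f| to f: with A(t) the integral of |f| over [0, t], consider
      T g (y) = y f(y) int_y^oo g(t) / (t A(t)) dt     ([spread]).
    Since C|f|(t) = A(t) / t, the integrand becomes t^-2 for g = C|f|, so that
    T (C|f|) = f ([spread_self]). Exchanging integrals and bounding
    int_0^z t |f(t)| dt by z A(z) gives C|T g| <= C|g| + C^*|g|
    ([spread_tonelli], [spread_cesaro]), and this is where the boundedness of C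
    and C^* on X enters: T maps X into CX with norm at most ||C|| + ||C^*||.

    Both operators act on the whole couple, so any interpolation method that
    respects bounded linear operators identifies the two spaces. For the
    K-method this is an inequality between K-functionals. For a functor F, one
    operator is only known to be bounded on the interpolated spaces, while
    equivalence of norms needs a constant uniform in f. That uniformity is
    automatic ([interp_uniform]): a family of operators with bounds growing too
    fast could be assembled into one operator with values in bounded sequences,
    contradicting the boundedness of the shift on such sequences under F.

    The remaining work shows that (X0, X1) and (CX0, CX1) are Banach couples. A
    pair of Banach spaces in which limits are compatible is a couple inside its
    own sum ([compatible_couple]). In a Banach ideal space, absolutely
    convergent series converge almost everywhere ([riesz_fischer]); hence limits
    in two such spaces agree ([ideal_compatible]), and CX is again a Banach
    ideal space ([CX_ideal]). *)

(** * Normed subspaces *)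

Section NormedSubspace.
Context {R : realType} {V : lmodType R}.
Implicit Types X Y : nspace V.

(** The part of the Banach space axioms that holds for a sum of spaces and for
    CX before completeness is known. *)
Record is_normed X : Prop := IsNormed {
  normed_dom0 : dom X 0;
  normed_domP : forall (a : R) x y, dom X x -> dom X y -> dom X (a *: x + y);
  normed_eq0 : forall x, dom X x -> nrm X x = 0 -> x = 0;
  normed_nrmZ : forall (a : R) x, dom X x -> nrm X (a *: x) = `|a| * nrm X x;
  normed_nrmD : forall x y, dom X x -> dom X y ->
    nrm X (x + y) <= nrm X x + nrm X y }.

Lemma banach_normed X : is_banach X -> is_normed X.
Proof. by case=> *; split. Qed.

Section Theory.
Variables (X : nspace V) (nX : is_normed X).

Lemma domD x y : dom X x -> dom X y -> dom X (x + y).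
Proof. by rewrite -{2}[x]scale1r; exact: normed_domP. Qed.

Lemma domZ a x : dom X x -> dom X (a *: x).
Proof. by move=> dx; rewrite -[_ *: _]addr0; apply: normed_domP (normed_dom0 nX). Qed.

Lemma domN x : dom X x -> dom X (- x).
Proof. by rewrite -scaleN1r; exact: domZ. Qed.

Lemma domB x y : dom X x -> dom X y -> dom X (x - y).
Proof. by move=> dx dy; apply: domD => //; exact: domN. Qed.

Lemma nrm0 : nrm X 0 = 0.
Proof. by rewrite -(scale0r (0 : V)) normed_nrmZ ?normr0 ?mul0r //; case: nX. Qed.

Lemma nrmN x : dom X x -> nrm X (- x) = nrm X x.
Proof. by move=> dx; rewrite -scaleN1r normed_nrmZ// normrN1 mul1r. Qed.

Lemma nrm_ge0 x : dom X x -> 0 <= nrm X x.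
Proof.
move=> dx; have := normed_nrmD nX dx (domN dx).
by rewrite subrr nrm0 nrmN// -mulr2n pmulrn_lge0.
Qed.

Lemma nrm_distC x y : dom X x -> dom X y -> nrm X (x - y) = nrm X (y - x).
Proof. by move=> dx dy; rewrite -nrmN ?opprB//; exact: domB. Qed.

Lemma dom_sum (u : nat -> V) n : (forall k, dom X (u k)) ->
  dom X (\sum_(k < n) u k).
Proof. by move=> du; elim/big_ind: _ => //; [case: nX|exact: domD]. Qed.

Lemma nrm_sum (u : nat -> V) n : (forall k, dom X (u k)) ->
  nrm X (\sum_(k < n) u k) <= \sum_(k < n) nrm X (u k).
Proof.
move=> du; elim: n => [|n IH]; first by rewrite !big_ord0 nrm0.
rewrite !big_ord_recr/=; apply: le_trans (normed_nrmD nX _ _) _ => //.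
  exact: dom_sum.
by rewrite lerD2r.
Qed.

End Theory.

Definition ncvg X (u : nat -> V) (a : V) : Prop :=
  (fun n => nrm X (u n - a)) @ \oo --> (0 : R).

(** Limits computed in the two spaces agree; this replaces an ambient
    topological space, which is built from it in [compatible_couple]. *)
Definition compatible X Y : Prop := forall (u : nat -> V) a b,
  (forall n, dom X (u n) /\ dom Y (u n)) -> dom X a -> dom Y b ->
  ncvg X u a -> ncvg Y u b -> a = b.

Lemma ncvgP X u a : is_normed X -> dom X a -> (forall n, dom X (u n)) ->
  ncvg X u a <-> forall e : R, 0 < e -> exists N, forall n, (N <= n)%N ->
    nrm X (u n - a) < e.
Proof.
move=> nX da du; have E n : `|0 - nrm X (u n - a)| = nrm X (u n - a).
  by rewrite sub0r normrN ger0_norm//; apply: nrm_ge0 => //; exact: domB.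
split=> [/cvgrPdist_lt h e e0|h].
  have /= [N _ hN] := h e e0; exists N => n Nn; rewrite -E; exact: hN.
apply/cvgrPdist_lt => e /h [N hN]; exists N => // n /= Nn; rewrite E; exact: hN.
Qed.

End NormedSubspace.

Lemma geo_sum_le (R : realType) n : \sum_(k < n) (2^-1 : R) ^+ k <= 2.
Proof.
have -> : \sum_(k < n) (2^-1 : R) ^+ k = 2 - 2 * 2^-1 ^+ n.
  elim: n => [|n IH]; first by rewrite big_ord0 expr0 mulr1 subrr.
  by rewrite big_ord_recr/= IH exprS; lra.
by rewrite gerBl mulr_ge0// exprn_ge0.
Qed.

Lemma geo_tail_lt (R : realType) (e : R) : 0 < e -> exists N, forall n, (N <= n)%N ->
  2 * 2^-1 ^+ n < e.
Proof.
move=> e0; exists (Num.truncn (2 / e)) => n Nn.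
have h : 2 / e < 2 ^+ n.
  apply: lt_le_trans (truncnS_gt _) _; rewrite -natrX ler_nat.
  exact: leq_ltn_trans Nn (ltn_expl n (ltnSn 1)).
by rewrite exprVn ltr_pdivrMr ?exprn_gt0// mulrC -ltr_pdivrMr.
Qed.

Section GeometricSeries.
Context {R : realType} {V : lmodType R}.
Variables (X : nspace V) (nX : is_normed X).

Lemma geo_cauchy (v : nat -> V) : (forall n, dom X (v n)) ->
  (forall n, nrm X (v n) <= 2^-1 ^+ n) -> forall m n, (n <= m)%N ->
  nrm X (\sum_(k < m) v k - \sum_(k < n) v k) <= 2 * 2^-1 ^+ n.
Proof.
move=> dv hv m n nm; rewrite -(subnKC nm); set r := (m - n)%N.
rewrite big_split_ord/= addrAC subrr add0r.
apply: le_trans (nrm_sum nX (u := fun k => v (n + k)%N) r _) _ => //.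
apply: le_trans (_ : \sum_(k < r) 2^-1 ^+ n * 2^-1 ^+ k <= _).
  by apply: ler_sum => k _; rewrite -exprD.
by rewrite -mulr_sumr mulrC ler_wpM2r ?exprn_ge0// geo_sum_le.
Qed.

(** A Cauchy sequence has a subsequence whose increments are dominated by a
    geometric sequence, and it converges as soon as this subsequence does. *)
Lemma banach_of_series :
  (forall v : nat -> V, (forall n, dom X (v n)) ->
     (forall n, nrm X (v n) <= 2^-1 ^+ n) ->
     exists2 x, dom X x & ncvg X (fun n => \sum_(k < n) v k) x) -> is_banach X.
Proof.
move=> hX; split; try by case: nX.
  by move=> x; exact: nrm_ge0.
move=> u du cu.
have /choice[N hN] : forall k, exists N : nat, forall m n : nat,
    (N <= m)%N -> (N <= n)%N -> nrm X (u m - u n) < 2^-1 ^+ k.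
  by move=> k; apply: cu; rewrite exprn_gt0.
pose j k := (\sum_(i < k.+1) N i)%N.
have jN k : (N k <= j k)%N by rewrite /j big_ord_recr/= leq_addl.
have jS k : (N k <= j k.+1)%N.
  by apply: leq_trans (jN k) _; rewrite [in leqRHS]/j big_ord_recr/= leq_addr.
pose v k := u (j k.+1) - u (j k).
have [k|k|x dx vx] := hX v.
- exact: domB.
- exact/ltW/hN.
have dv n : dom X (\sum_(k < n) v k) by apply: dom_sum => // k; exact: domB.
have vE n : \sum_(k < n) v k = u (j n) - u (j 0%N).
  elim: n => [|n IH]; first by rewrite big_ord0 subrr.
  by rewrite big_ord_recr/= IH /v addrC addrA subrK.
exists (x + u (j 0%N)); first exact: domD.
apply/ncvgP => //; first exact: domD.
move=> e e0; have e2 : 0 < e / 2 by rewrite divr_gt0.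
have [M hM] := cu _ e2.
move/ncvgP : vx => /(_ nX dx dv _ e2)[M' hM'].
have [M'' hM''] := geo_tail_lt e2.
exists M => n Mn; pose r := maxn M' M''.
have -> : u n - (x + u (j 0%N)) = (u n - u (j r)) + (\sum_(k < r) v k - x).
  by rewrite vE -[u (j r) - _ - _]addrA subrKA opprD [- x + _]addrC.
apply: le_lt_trans (normed_nrmD nX _ _) _; try exact: domB.
rewrite [ltRHS](splitr e); apply: ltrD; last by apply: hM'; rewrite leq_maxl.
(* beyond j r the sequence is controlled by the tail of index r, and before
   it by the Cauchy condition for e / 2 *)
have [Mj|jM] := leqP M (j r); first exact: hM.
have hr : (N r <= n)%N by apply: leq_trans (jN r) (leq_trans (ltnW jM) Mn).
apply: lt_trans (hN r _ _ hr (jN r)) _.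
apply: le_lt_trans (hM'' r _); last by rewrite leq_maxr.
by rewrite ler_peMl ?exprn_ge0// ler1n.
Qed.

End GeometricSeries.

(** * The K-functional *)

Section Kfunctional.
Context {R : realType} {V : lmodType R}.
Variables (Y0 Y1 : nspace V).
Hypotheses (n0 : is_normed Y0) (n1 : is_normed Y1).

Local Notation Kset t x := [set r | exists x0 x1,
  [/\ dom Y0 x0, dom Y1 x1, x = x0 + x1 & r = nrm Y0 x0 + t * nrm Y1 x1]].

Lemma Kset_ge0 (t : R) x : 0 <= t -> lbound (Kset t x) 0.
Proof.
move=> t0 r [x0] [x1] [d0 d1 _ ->].
by apply: addr_ge0; [exact: nrm_ge0|apply: mulr_ge0 => //; exact: nrm_ge0].
Qed.

Lemma Kfun_le (t : R) x0 x1 : 0 <= t -> dom Y0 x0 -> dom Y1 x1 ->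
  Kfun Y0 Y1 t (x0 + x1) <= nrm Y0 x0 + t * nrm Y1 x1.
Proof.
move=> t0 d0 d1; apply: ge_inf; first by exists 0; exact: Kset_ge0.
by exists x0, x1.
Qed.

Lemma Kfun_has_inf (t : R) x : 0 <= t -> dom (nsum Y0 Y1) x ->
  has_inf (Kset t x).
Proof.
move=> t0 [x0 [x1 [d0 d1 ->]]]; split; last by exists 0; exact: Kset_ge0.
by exists (nrm Y0 x0 + t * nrm Y1 x1), x0, x1.
Qed.

Lemma Kfun_lt (t e : R) x : 0 <= t -> 0 < e -> dom (nsum Y0 Y1) x ->
  exists x0 x1, [/\ dom Y0 x0, dom Y1 x1, x = x0 + x1 &
    nrm Y0 x0 + t * nrm Y1 x1 < Kfun Y0 Y1 t x + e].
Proof.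
move=> t0 e0 dx; have [r [x0 [x1 [? ? ? ->]]] rlt] :=
  inf_adherent e0 (Kfun_has_inf t0 dx).
by exists x0, x1.
Qed.

Lemma Kfun_lub (t r : R) x : dom (nsum Y0 Y1) x ->
  (forall x0 x1, dom Y0 x0 -> dom Y1 x1 -> x = x0 + x1 ->
     r <= nrm Y0 x0 + t * nrm Y1 x1) -> r <= Kfun Y0 Y1 t x.
Proof.
move=> [x0 [x1 [d0 d1 xE]]] h; apply: lb_le_inf.
  by exists (nrm Y0 x0 + t * nrm Y1 x1), x0, x1.
by move=> _ [y0 [y1 [? ? ? ->]]]; exact: h.
Qed.

Lemma Kfun_ge0 (t : R) x : 0 <= t -> dom (nsum Y0 Y1) x -> 0 <= Kfun Y0 Y1 t x.
Proof.
move=> t0 dx; apply: Kfun_lub => // x0 x1 d0 d1 _.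
by apply: addr_ge0; [exact: nrm_ge0|apply: mulr_ge0 => //; exact: nrm_ge0].
Qed.

Lemma Kfun_nondecreasing x : dom (nsum Y0 Y1) x ->
  forall s t : R, 0 <= s -> s <= t -> Kfun Y0 Y1 s x <= Kfun Y0 Y1 t x.
Proof.
move=> dx s t s0 st; apply: Kfun_lub => // x0 x1 d0 d1 ->.
apply: le_trans (Kfun_le s0 d0 d1) _; rewrite lerD2l ler_wpM2r//.
exact: nrm_ge0.
Qed.

Lemma nsum_dom0 : dom (nsum Y0 Y1) 0.
Proof. by exists 0, 0; split; [case: n0|case: n1|rewrite addr0]. Qed.

Lemma nsum_l x : dom Y0 x -> dom (nsum Y0 Y1) x.
Proof. by move=> dx; exists x, 0; split=> //; [case: n1|rewrite addr0]. Qed.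

Lemma nsum_r x : dom Y1 x -> dom (nsum Y0 Y1) x.
Proof. by move=> dx; exists 0, x; split=> //; [case: n0|rewrite add0r]. Qed.

Lemma nsum_domP (a : R) x y : dom (nsum Y0 Y1) x -> dom (nsum Y0 Y1) y ->
  dom (nsum Y0 Y1) (a *: x + y).
Proof.
move=> [x0 [x1 [? ? ->]]] [y0 [y1 [? ? ->]]].
exists (a *: x0 + y0), (a *: x1 + y1); split; try exact: normed_domP.
by rewrite scalerDr addrACA.
Qed.

Lemma KfunZ_le (t a : R) x : 0 <= t -> dom (nsum Y0 Y1) x ->
  Kfun Y0 Y1 t (a *: x) <= `|a| * Kfun Y0 Y1 t x.
Proof.
move=> t0 dx; have [->|a0] := eqVneq a 0.
  rewrite normr0 mul0r scale0r -{1}(addr0 (0 : V)).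
  apply: le_trans (Kfun_le t0 (normed_dom0 n0) (normed_dom0 n1)) _.
  by rewrite !nrm0// mulr0 addr0.
have a0' : 0 < `|a| by rewrite normr_gt0.
rewrite -ler_pdivrMl//; apply: Kfun_lub => // x0 x1 d0 d1 ->.
rewrite ler_pdivrMl// scalerDr mulrDr mulrCA -!normed_nrmZ//.
by apply: Kfun_le => //; exact: domZ.
Qed.

Hypothesis cpt : compatible Y0 Y1.

(** Decompositions of x with norms tending to 0 differ from a fixed one by a
    sequence in the intersection which converges in both spaces; compatibility
    then makes the fixed decomposition cancel. *)
Lemma Kfun1_eq0 x : dom (nsum Y0 Y1) x -> Kfun Y0 Y1 1 x = 0 -> x = 0.
Proof.
move=> dx K0; have [a [b [da db xE]]] := dx.
have /choice[y hy] : forall n : nat, exists y : V * V,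
    [/\ dom Y0 y.1, dom Y1 y.2, x = y.1 + y.2 &
      nrm Y0 y.1 + nrm Y1 y.2 < n.+1%:R^-1].
  move=> n; have n0' : 0 < n.+1%:R^-1 :> R by rewrite invr_gt0.
  have [x0 [x1 [? ? ?]]] := Kfun_lt ler01 n0' dx.
  by rewrite K0 add0r mul1r => ?; exists (x0, x1).
suff ab : a = - b by rewrite xE ab addNr.
pose u n := a - (y n).1.
have uE n : u n = (y n).2 - b.
  have [_ _ e _] := hy n; apply/eqP; rewrite /u subr_eq addrAC eq_sym subr_eq.
  by rewrite addrC -e xE.
have lim e : 0 < e -> exists N, forall n, (N <= n)%N -> n.+1%:R^-1 < e :> R.
  move=> e0; exists (Num.truncn e^-1) => n Nn.
  rewrite invf_plt ?posrE//.
  apply: lt_le_trans (truncnS_gt _) _.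
  by rewrite ler_nat.
have dy n : dom Y0 (y n).1 /\ dom Y1 (y n).2 by have [] := hy n.
have du n : dom Y0 (u n) /\ dom Y1 (u n).
  have [d0 d1] := dy n.
  by split; [exact: domB | rewrite uE; exact: domB].
apply: (cpt (u := u)) => //; first exact: domN.
  apply/ncvgP => // [n|e /lim[N hN]]; first by have [] := du n.
  exists N => n /hN; apply: le_lt_trans; have [d0 d1 _ /ltW] := hy n.
  rewrite /u addrAC subrr add0r nrmN//; apply: le_trans; rewrite lerDl.
  exact: nrm_ge0.
apply/ncvgP => // [|n|e /lim[N hN]]; first exact: domN.
  by have [] := du n.
exists N => n /hN; apply: le_lt_trans; have [d0 d1 _ /ltW] := hy n.
rewrite uE opprK subrK; apply: le_trans; rewrite lerDr; exact: nrm_ge0.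
Qed.

Lemma nsum_normed : is_normed (nsum Y0 Y1).
Proof.
split; [exact: nsum_dom0|exact: nsum_domP|exact: Kfun1_eq0| |].
- move=> a x dx; apply/eqP; rewrite eq_le KfunZ_le//=.
  have [->|a0] := eqVneq a 0.
    by rewrite normr0 mul0r scale0r; apply: Kfun_ge0 => //; exact: nsum_dom0.
  have dax : dom (nsum Y0 Y1) (a *: x).
    by rewrite -[_ *: _]addr0; apply: nsum_domP => //; exact: nsum_dom0.
  have := KfunZ_le a^-1 ler01 dax.
  rewrite scalerA mulVf// scale1r normfV => h.
  by rewrite -ler_pdivlMl// normr_gt0.
- move=> x y dx dy /=; apply/ler_addgt0Pr => e e0.
  have e2 : 0 < e / 2 by rewrite divr_gt0.
  have [x0 [x1 [dx0 dx1 -> hx]]] := Kfun_lt ler01 e2 dx.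
  have [y0 [y1 [dy0 dy1 -> hy]]] := Kfun_lt ler01 e2 dy.
  rewrite addrACA; apply: le_trans (Kfun_le ler01 (domD n0 dx0 dy0) (domD n1 dx1 dy1)) _.
  have := normed_nrmD n0 dx0 dy0; have := normed_nrmD n1 dx1 dy1.
  move: hx hy; lra.
Qed.

End Kfunctional.

(** * Compatible spaces form a couple *)

Section Carrier.
Context {R : realType} {V : lmodType R}.

(** Only the sum of the two spaces carries the norm K(1, .), so the ambient
    normed module of a couple has to be a subtype of V. *)
Record normed_subspace := NormedSubspace {
  subspace_of :> nspace V;
  subspaceP : is_normed subspace_of }.

Variable S : normed_subspace.

Definition in_subspace : {pred V} := [pred x | x \in dom S].

Lemma in_subspace_submod : submod_closed in_subspace.
Proof.
split=> [|a x y]; rewrite !inE; first exact: normed_dom0 (subspaceP S).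
exact: normed_domP (subspaceP S) _ _ _.
Qed.

HB.instance Definition _ :=
  GRing.isSubmodClosed.Build R V in_subspace in_subspace_submod.

Record carrier := Carrier { carrier_val :> V; _ : carrier_val \in in_subspace }.

HB.instance Definition _ := [isSub for carrier_val].
HB.instance Definition _ := [Choice of carrier by <:].
HB.instance Definition _ := [SubChoice_isSubLmodule of carrier by <:].

Lemma carrierP (x : carrier) : dom S (val x).
Proof. by case: x => x /= /[!inE]. Qed.

Definition carrier_norm (x : carrier) : R := nrm S (val x).

Lemma carrier_normD x y :
  carrier_norm (x + y) <= carrier_norm x + carrier_norm y.
Proof. by apply: (normed_nrmD (subspaceP S)); exact: carrierP. Qed.

Lemma carrier_normZ a x : carrier_norm (a *: x) = `|a| * carrier_norm x.
Proof. by apply: (normed_nrmZ (subspaceP S)); exact: carrierP. Qed.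

Lemma carrier_norm_eq0 x : carrier_norm x = 0 -> x = 0.
Proof.
by move=> x0; apply/val_inj/(normed_eq0 (subspaceP S)) => //; exact: carrierP.
Qed.

HB.instance Definition _ := Lmodule_isNormed.Build R carrier
  carrier_normD carrier_normZ carrier_norm_eq0.

End Carrier.

(** The ambient space is Y0 + Y1 with the norm K(1, .), for which both
    inclusions have norm at most 1. *)
Lemma compatible_couple (R : realType) (V : lmodType R) (Y0 Y1 : nspace V) :
  is_banach Y0 -> is_banach Y1 -> compatible Y0 Y1 -> banach_couple Y0 Y1.
Proof.
move=> b0 b1 c; split=> //.
have n0 := banach_normed b0; have n1 := banach_normed b1.
pose S := NormedSubspace (nsum_normed n0 n1 c).
pose W : normedModType R := carrier S.
pose j (x : V) : W := insubd (0 : carrier S) x.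
have jE x : dom S x -> val (j x) = x.
  by move=> dx; rewrite /j val_insubd mem_set.
have domJ (x : V) (dx : dom S x) : `|j x| = nrm S x.
  by rewrite -[in RHS](jE x).
exists W, j; split.
- exact: norm_hausdorff.
- move=> a x y dx dy; apply: val_inj; have dxy := nsum_domP n0 n1 a dx dy.
  by rewrite [RHS](linearP (val : W -> V)) /= !jE.
- by move=> x y /set_mem dx /set_mem dy /(congr1 val); rewrite !jE.
- move=> U /nbhs_ballP[e /= e0 eU]; exists e => // x dx xe.
  apply: eU; rewrite -ball_normE/= sub0r normrN domJ ?nsum_l//; last exact: nsum_l.
  apply: le_lt_trans xe.
  rewrite /= -{1}[x]addr0.
  apply: le_trans (Kfun_le n0 n1 ler01 dx (normed_dom0 n1)) _.
  by rewrite nrm0// mulr0 addr0.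
- move=> U /nbhs_ballP[e /= e0 eU]; exists e => // x dx xe.
  apply: eU; rewrite -ball_normE/= sub0r normrN domJ; last exact: nsum_r.
  apply: le_lt_trans xe.
  rewrite /= -{1}[x]add0r.
  apply: le_trans (Kfun_le n0 n1 ler01 (normed_dom0 n0) dx) _.
  by rewrite nrm0// mul1r add0r.
Qed.

(** * Uniform bounds for interpolated operators *)

Definition bounded_by (R : realType) (V W : lmodType R) (M : R) (Y : nspace V)
    (Z : nspace W) (T : V -> W) : Prop :=
  forall x, dom Y x -> dom Z (T x) /\ nrm Z (T x) <= M * nrm Y x.

Section BoundedSequences.
Context {R : realType} {W : lmodType R}.
Implicit Types Z : nspace W.

Definition linf Z : nspace (nat -> W) :=
  NSpace [set u | (forall n, dom Z (u n)) /\
                  exists M, forall n, nrm Z (u n) <= M]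
         (fun u => sup (range (fun n => nrm Z (u n)))).

Lemma linf_ub Z u n : dom (linf Z) u -> nrm Z (u n) <= nrm (linf Z) u.
Proof.
move=> [_ [M hM]]; apply: sup_upper_bound; last by exists n.
by split; [exists (nrm Z (u 0)), 0 | exists M => _ [k _ <-]; exact: hM].
Qed.

Lemma linf_lub Z u M : (forall n, nrm Z (u n) <= M) -> nrm (linf Z) u <= M.
Proof.
move=> hM; apply: ge_sup; first by exists (nrm Z (u 0)), 0.
by move=> _ [n _ <-]; exact: hM.
Qed.

Lemma linf_normed Z : is_normed Z -> is_normed (linf Z).
Proof.
move=> nZ; split.
- by split=> [n|]; [exact: normed_dom0|exists 0 => n; rewrite (nrm0 nZ)].
- move=> a x y [dx [M hM]] [dy [N hN]]; split=> [n|]; first exact: normed_domP.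
  exists (`|a| * M + N) => n.
  apply: le_trans (normed_nrmD nZ (domZ nZ a (dx n)) (dy n)) _.
  by rewrite normed_nrmZ// lerD// ler_wpM2l.
- move=> x dx x0; apply/funext => n; have [dxn _] := dx.
  apply: (normed_eq0 nZ) => //; apply/eqP; rewrite eq_le nrm_ge0// andbT -x0.
  exact: linf_ub.
- move=> a x dx; have [dxn [M hM]] := dx; apply/eqP; rewrite eq_le.
  have h : nrm (linf Z) (a *: x) <= `|a| * nrm (linf Z) x.
    apply: linf_lub => n; rewrite [_ n]/= normed_nrmZ// ler_wpM2l//.
    exact: linf_ub.
  rewrite h /=; have [->|a0] := eqVneq a 0.
    rewrite normr0 mul0r scale0r; apply: le_trans (linf_ub 0 _).
      by rewrite nrm0.
    by split=> [n|]; [exact: normed_dom0|exists 0 => n; rewrite (nrm0 nZ)].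
  rewrite -ler_pdivlMl ?normr_gt0//; apply: linf_lub => n.
  rewrite ler_pdivlMl ?normr_gt0// -normed_nrmZ//.
  apply: (@linf_ub Z (a *: x)); split=> [k|]; first exact: domZ.
  by exists (`|a| * M) => k; rewrite [_ k]/= normed_nrmZ// ler_wpM2l.
- move=> x y dx dy; apply: linf_lub => n.
  apply: le_trans (normed_nrmD nZ (proj1 dx n) (proj1 dy n)) _.
  by apply: lerD; exact: linf_ub.
Qed.

Lemma linf_banach Z : is_banach Z -> is_banach (linf Z).
Proof.
move=> bZ; have nZ := banach_normed bZ; have nL := linf_normed nZ.
case: (nL) => h0 hP he hZ hD; split => //.
  by move=> x dx; exact: nrm_ge0.
move=> u du cu.
have dun m k : dom Z (u m k) by have [] := du m.
have ck k e : 0 < e -> exists N : nat, forall m n : nat,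
    (N <= m)%N -> (N <= n)%N -> nrm Z (u m k - u n k) < e.
  move=> /cu[N hN]; exists N => m n Nm Nn.
  apply: le_lt_trans (hN _ _ Nm Nn).
  by apply: (@linf_ub Z (u m - u n)); exact: domB.
have /choice[x hx] : forall k, exists x, dom Z x /\ ncvg Z (fun n => u n k) x.
  move=> k; have [//|x dx ux] := banach_complete bZ (u := fun n => u n k) _ (ck k).
  by exists x.
have dx k : dom Z (x k) by have [] := hx k.
have ux e : 0 < e -> exists N, forall n k, (N <= n)%N -> nrm Z (u n k - x k) <= e.
  move=> e0; have [N hN] := cu _ e0; exists N => n k Nn.
  apply/ler_addgt0Pr => d d0.
  have /(ncvgP nZ (dx k) (fun n => dun n k))/(_ d d0)[N' hN'] := (hx k).2.
  pose m := maxn N N'.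
  have -> : u n k - x k = (u n k - u m k) + (u m k - x k).
    by rewrite addrA subrK.
  apply: le_trans (normed_nrmD nZ _ _) _; try exact: domB.
  apply: lerD; last by apply/ltW/hN'; rewrite leq_maxr.
  apply: le_trans (ltW (hN n m Nn _)); last by rewrite leq_maxl.
  by apply: (@linf_ub Z (u n - u m)); exact: domB.
have dX : dom (linf Z) x.
  split=> //; have [N hN] := ux 1 ltr01; have [_ [M hM]] := du N.
  exists (1 + M) => k; have -> : x k = - (u N k - x k) + u N k.
    by rewrite opprB subrK.
  apply: le_trans (normed_nrmD nZ _ _) _ => //; first exact/domN/domB.
  by rewrite nrmN; [rewrite lerD// hN|exact: nZ|exact: domB].
exists x => //; apply/ncvgP => // e e0.
have e2 : 0 < e / 2 by rewrite divr_gt0.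
have [N hN] := ux _ e2; exists N => n Nn.
apply: le_lt_trans (_ : e / 2 < e); last by rewrite ltr_pdivrMr// ltr_pMr// ltr1n.
by apply: linf_lub => k; exact: hN.
Qed.

Lemma linf_compatible Z0 Z1 : is_normed Z0 -> is_normed Z1 ->
  compatible Z0 Z1 -> compatible (linf Z0) (linf Z1).
Proof.
move=> n0 n1 cZ u a b du da db ua ub; apply/funext => k.
have l0 := linf_normed n0; have l1 := linf_normed n1.
have du0 n : dom (linf Z0) (u n) by have [] := du n.
have du1 n : dom (linf Z1) (u n) by have [] := du n.
apply: (cZ (fun n => u n k)).
- by move=> n; split; [have [] := du0 n|have [] := du1 n].
- by have [] := da.
- by have [] := db.
- apply/ncvgP => // [|n|e e0]; [by have [] := da|by have [] := du0 n|].
  move/ncvgP: ua => /(_ l0 da du0 e e0)[N hN]; exists N => n Nn.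
  apply: le_lt_trans (hN n Nn).
  by apply: (@linf_ub Z0 (u n - a)); exact: domB.
- apply/ncvgP => // [|n|e e0]; [by have [] := db|by have [] := du1 n|].
  move/ncvgP: ub => /(_ l1 db du1 e e0)[N hN]; exists N => n Nn.
  apply: le_lt_trans (hN n Nn).
  by apply: (@linf_ub Z1 (u n - b)); exact: domB.
Qed.

Definition shift (u : nat -> W) : nat -> W := fun n => u n.+1.

Lemma shift_bounded Z : is_normed Z -> bounded_by 1 (linf Z) (linf Z) shift.
Proof.
move=> nZ u du; have [dn [M hM]] := du; split.
  by split=> [n|]; [exact: dn|exists M => n; exact: hM].
by rewrite mul1r; apply: linf_lub => n; exact: (@linf_ub Z u n.+1 du).
Qed.

Lemma eval0_bounded Z : is_normed Z ->
  bounded_by 1 (linf Z) Z (fun u : nat -> W => u 0%N).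
Proof.
by move=> nZ u du; rewrite mul1r; split; [have [] := du|exact: linf_ub].
Qed.

End BoundedSequences.

(** Otherwise some operators T_n satisfy the hypotheses but have norms on F(Y)
    growing faster than a prescribed geometric sequence. As coordinates of one
    operator D into bounded sequences they satisfy T_n = e_0 S^n D, with S the
    shift and e_0 the first coordinate; the boundedness of e_0, S and D under F
    makes the norms of the T_n grow at most geometrically. *)
Lemma interp_uniform (R : realType) (F : couple_map R) (V W : lmodType R)
    (Y0 Y1 : nspace V) (Z0 Z1 : nspace W) (M : R) :
  interpolation_functor F ->
  is_banach Y0 -> is_banach Y1 -> compatible Y0 Y1 ->
  is_banach Z0 -> is_banach Z1 -> compatible Z0 Z1 ->
  exists c, forall T : V -> W, linear_on (dom (nsum Y0 Y1)) T ->
    bounded_by M Y0 Z0 T -> bounded_by M Y1 Z1 T ->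
    bounded_by c (F V Y0 Y1) (F W Z0 Z1) T.
Proof.
move=> fF b0 b1 cY d0 d1 cZ; apply: contrapT => /forallNP noc.
have m0 := banach_normed d0; have m1 := banach_normed d1.
have CY := compatible_couple b0 b1 cY.
have CZ := compatible_couple d0 d1 cZ.
have CL := compatible_couple (linf_banach d0) (linf_banach d1)
  (linf_compatible m0 m1 cZ).
have nFZ := banach_normed (interp_banach fF CZ).
have nFY := banach_normed (interp_banach fF CY).
have nFL := banach_normed (interp_banach fF CL).
have [s hs] : bounded_op (F _ (linf Z0) (linf Z1)) (F _ (linf Z0) (linf Z1)) shift.
  by apply: interp_op => //; exists 1; exact: shift_bounded.
have [p hp] : bounded_op (F _ (linf Z0) (linf Z1)) (F _ Z0 Z1) (fun u => u 0%N).
  by apply: interp_op => //; exists 1; exact: eval0_bounded.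
have /choice[T hT] : forall n : nat, exists T : V -> W,
    [/\ linear_on (dom (nsum Y0 Y1)) T, bounded_by M Y0 Z0 T,
      bounded_by M Y1 Z1 T &
      exists2 y, dom (F V Y0 Y1) y &
      n%:R * (`|s| + 1) ^+ n * nrm (F V Y0 Y1) y < nrm (F W Z0 Z1) (T y)].
  move=> n; apply: contrapT => noT.
  apply: (noc (n%:R * (`|s| + 1) ^+ n)) => T lT T0 T1 y dy; split.
    have [c hc] : bounded_op (F V Y0 Y1) (F W Z0 Z1) T.
      by apply: interp_op => //; exists M.
    by have [] := hc y dy.
  by rewrite leNgt; apply/negP => hlt; apply: noT; exists T; split=> //; exists y.
pose D y : nat -> W := fun n => T n y.
have [d hd] : bounded_op (F V Y0 Y1) (F _ (linf Z0) (linf Z1)) D.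
  apply: interp_op => //.
  - move=> a x y dx dy; apply/funext => n; have [lT _ _ _] := hT n; exact: lT.
  - exists M => x dx; split; last first.
      by apply: linf_lub => n; have [_ /(_ x dx)[]] := hT n.
    split=> [n|]; first by have [_ /(_ x dx)[]] := hT n.
    by exists (M * nrm Y0 x) => n; have [_ /(_ x dx)[]] := hT n.
  - exists M => x dx; split; last first.
      by apply: linf_lub => n; have [_ _ /(_ x dx)[]] := hT n.
    split=> [n|]; first by have [_ _ /(_ x dx)[]] := hT n.
    by exists (M * nrm Y1 x) => n; have [_ _ /(_ x dx)[]] := hT n.
have hsn n u : dom (F _ (linf Z0) (linf Z1)) u ->
    dom (F _ (linf Z0) (linf Z1)) (fun k => u (n + k)%N) /\
    nrm (F _ (linf Z0) (linf Z1)) (fun k => u (n + k)%N) <=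
      `|s| ^+ n * nrm (F _ (linf Z0) (linf Z1)) u.
  elim: n u => [|n IH] u du; first by rewrite expr0 mul1r.
  have [du1 hu1] := hs u du; have [du2 hu2] := IH _ du1.
  have E : (fun k => u (n.+1 + k)%N) = (fun k => shift u (n + k)%N) by [].
  rewrite E; split=> //; apply: le_trans hu2 _.
  rewrite exprSr -mulrA ler_wpM2l ?exprn_ge0//.
  apply: le_trans hu1 _; rewrite ler_wpM2r ?ler_norm//.
  exact: nrm_ge0.
(* n exceeds the norms of e_0 and D, and the power exceeds that of S^n *)
pose n := (Num.truncn (`|p| * `|d|)).+1.
have [_ _ _ [y dy]] := hT n; apply/negP; rewrite -leNgt.
have [dD hD] := hd y dy.
have [dS hS] := hsn n _ dD.
have [_] := hp _ dS; rewrite /D addn0 => /le_trans; apply.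
have ny := nrm_ge0 nFY dy.
have nD := nrm_ge0 nFL dD.
have nS := nrm_ge0 nFL dS.
apply: le_trans (_ : `|p| * (`|s| ^+ n * (`|d| * nrm (F V Y0 Y1) y)) <= _).
  apply: le_trans (_ : `|p| * (nrm (F _ (linf Z0) (linf Z1))
    (fun k => D y (n + k)%N)) <= _); first by rewrite ler_wpM2r// ler_norm.
  rewrite ler_wpM2l//; apply: le_trans hS _; rewrite ler_wpM2l ?exprn_ge0//.
  by apply: le_trans hD _; rewrite ler_wpM2r// ler_norm.
rewrite !mulrA ler_wpM2r// mulrAC.
apply: ler_pM; rewrite ?mulr_ge0 ?exprn_ge0//.
  exact/ltW/truncnS_gt.
by rewrite lerXn2r ?nnegrE ?addr_ge0// lerDl.
Qed.

(** * Almost everywhere on the half-line *)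

#[global] Instance ae_leb_filter (R : realType) :
  Filter (nbhs (almost_everywhere (@lebesgue_measure R))).
Proof. exact: ae_filter_ringOfSetsType. Qed.

#[global] Instance ae_lebI_filter (R : realType) :
  Filter (nbhs (almost_everywhere (@Defs.lebI R))).
Proof. exact: ae_filter_ringOfSetsType. Qed.

Section HalfLine.
Context {R : realType}.
Local Notation T := (measurableTypeR R).
Local Notation leb := (@lebesgue_measure R).
Local Notation lebI := (@lebI R).
Implicit Types (f g u v : L0 R) (X : nspace (L0 R)).

Lemma ae_lebI (P : T -> Prop) : {ae lebI, forall x, P x} <->
  {ae leb, forall x, 0 <= x -> P x}.
Proof.
have hE x : @halfline R x <-> 0 <= x.
  by rewrite /halfline/= in_itv/= andbT.
split=> -[N [mN N0 PN]].
- exists (N `&` @halfline R); split=> //.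
    by apply: measurableI => //; exact: measurable_halfline.
  by move=> x /= /not_implyP[x0 Px]; split; [exact: PN|exact/hE].
- exists (N `|` ~` @halfline R); split.
  + apply: measurableU => //; apply: measurableC; exact: measurable_halfline.
  + rewrite /lebI/= /mrestr setIUl setICl setU0; apply: (subset_measure0 _ _ _ N0) => //.
    by apply: measurableI => //; exact: measurable_halfline.
  + move=> x /= Px; have [x0|/negP x0] := boolP (0 <= x); last first.
      by right => /hE.
    by left; apply: PN => /= h; apply: Px; exact: h.
Qed.

Lemma ae_pos : {ae lebI, forall x : T, (0 : R) < x}.
Proof.
apply/ae_lebI; exists [set 0]; split; [exact: measurable_set1|exact: lebesgue_measure_set1|].
move=> x /= /not_implyP[x0 /negP]; rewrite -leNgt => x0'.
by apply/eqP; rewrite eq_le x0 x0'.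
Qed.

Lemma addE f g : {ae lebI, forall x, L0_fun (f + g) x = f x + g x}.
Proof. exact: L0_addE. Qed.
Lemma oppE f : {ae lebI, forall x, L0_fun (- f) x = - f x}.
Proof. exact: L0_oppE. Qed.
Lemma scaleE a f : {ae lebI, forall x, L0_fun (a *: f) x = a * f x}.
Proof. exact: L0_scaleE. Qed.
Lemma zeroE : {ae lebI, forall x, L0_fun (0 : L0 R) x = 0}.
Proof. exact: L0_zeroE. Qed.
Lemma subE f g : {ae lebI, forall x, L0_fun (f - g) x = f x - g x}.
Proof.
by near=> x; rewrite (near (addE f (- g)) x) // (near (oppE g) x).
Unshelve. all: by end_near. Qed.

Lemma sumE (u : nat -> L0 R) n :
  {ae lebI, forall x, L0_fun (\sum_(k < n) u k) x = \sum_(k < n) u k x}.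
Proof.
elim: n => [|n IH].
  by rewrite big_ord0; near=> x; rewrite big_ord0 (near zeroE x).
rewrite big_ord_recr/=; near=> x.
by rewrite big_ord_recr/= (near (addE _ _) x)// (near IH x).
Unshelve. all: by end_near. Qed.

Lemma L0_measurable f : measurable_fun [set: T] (f : T -> R).
Proof. exact: (measurable_funPT (repr f)). Qed.

Lemma L0_ex (h : T -> R) : measurable_fun [set: T] h ->
  exists f, {ae lebI, forall x, f x = h x}.
Proof.
move=> mh; pose k : {mfun T >-> R} := mfun_Sub (mem_set mh).
by exists (L0_class k); have := L0_classE k.
Qed.

Definition absL f : L0 R := xget 0 [set g : L0 R | {ae lebI, forall x, g x = `|f x|}].

Lemma absLE f : {ae lebI, forall x, absL f x = `|f x|}.
Proof.
rewrite /absL; case: xgetP => [g _ //|noex].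
have mf : measurable_fun [set: T] (fun x => `|f x|).
  by apply: measurableT_comp => //; exact: L0_measurable.
by have [g gE] := L0_ex mf; have := noex g gE.
Qed.

Lemma represents_ex (h : T -> \bar R) : measurable_fun (@halfline R) h ->
  {ae lebI, forall x, h x \is a fin_num} -> exists g, represents h g.
Proof.
move=> mh fh.
have mh' : measurable_fun [set: T] (fun x => fine ((h \_ (@halfline R)) x)).
  apply: measurableT_comp => //.
  by apply/(measurable_restrictT h (@measurable_halfline R)).
have [g gE] := L0_ex mh'; exists g; apply/ae_lebI.
move/ae_lebI : gE => gE; move/ae_lebI : fh => fh.
near=> x => x0; rewrite (near gE x)// patchE ifT.
  by rewrite fineK// (near fh x).
by apply/mem_set; rewrite /halfline/= in_itv/= x0.
Unshelve. all: by end_near. Qed.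

Lemma represents_eq (h h' : T -> \bar R) g g' : represents h g ->
  represents h' g' -> {ae lebI, forall x, h x = h' x} -> g = g'.
Proof.
move=> hg hg' hh'; apply/L0P; near=> x; apply: EFin_inj.
by rewrite (near hg x)// (near hg' x)// (near hh' x).
Unshelve. all: by end_near. Qed.

Lemma represents_xget (h : T -> \bar R) g : represents h g ->
  xget 0 (represents h) = g.
Proof.
move=> hg; case: xgetP => [k _ hk|/(_ g)//].
by apply: represents_eq hk hg _; exact: aeW.
Qed.

Lemma ae_forall (P : nat -> T -> Prop) :
  (forall n, {ae lebI, forall x, P n x}) -> {ae lebI, forall x, forall n, P n x}.
Proof. by move=> h; apply: ae_foralln. Qed.

(** * Convergence in Banach ideal spaces *)

Section Ideal.
Variables (X : nspace (L0 R)) (iX : banach_ideal X).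
Let nX := banach_normed (ideal_banach iX).

Lemma absL_dom f : dom X f -> dom X (absL f) /\ nrm X (absL f) = nrm X f.
Proof.
move=> df; have [d1 l1] : dom X (absL f) /\ nrm X (absL f) <= nrm X f.
  apply: ideal_solid => //.
  by near=> x; rewrite (near (absLE f) x)// normr_id.
split=> //; apply/eqP; rewrite eq_le l1/=.
apply: (ideal_solid iX _ d1).2.
by near=> x; rewrite (near (absLE f) x)// normr_id.
Unshelve. all: by end_near. Qed.

Lemma ideal_le f g : {ae lebI, forall x, 0 <= f x <= g x} -> dom X g ->
  dom X f /\ nrm X f <= nrm X g.
Proof.
move=> fg dg; apply: (ideal_solid iX _ dg).
near=> x; have /andP[f0 fgx] : 0 <= f x <= g x by near: x.
by rewrite !ger0_norm//; exact: le_trans fgx.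
Unshelve. all: by end_near. Qed.

(** Norm limits respect pointwise bounds: the positive part of p n - s is
    dominated by p m - s for all large m. *)
Lemma ncvg_mono_ub (p : nat -> L0 R) (s : L0 R) : (forall n, dom X (p n)) -> dom X s ->
  (forall m n, (n <= m)%N -> {ae lebI, forall x, p n x <= p m x}) ->
  ncvg X p s -> forall n, {ae lebI, forall x, p n x <= s x}.
Proof.
move=> dp ds pmono /(ncvgP nX ds dp) ps n.
have [d dE] : exists d : L0 R, {ae lebI, forall x, d x = Num.max (p n x - s x) 0}.
  apply: L0_ex; apply: measurable_maxr => //.
  by apply: measurable_funB; exact: L0_measurable.
have dd m : (n <= m)%N -> dom X d /\ nrm X d <= nrm X (p m - s).
  move=> nm; apply: ideal_solid => //; last exact: domB.
  near=> x; rewrite (near dE x)// (near (subE (p m) s) x)//.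
  have pnm : p n x <= p m x by near: x; exact: pmono.
  rewrite ger0_norm ?le_max ?lexx ?orbT// ge_max normr_ge0 andbT.
  by apply: le_trans (ler_norm _); rewrite lerD2r.
have d0 : d = 0.
  apply: (normed_eq0 nX); first by have [] := dd n (leqnn n).
  apply/eqP; rewrite eq_le nrm_ge0 ?andbT//; last by have [] := dd n (leqnn n).
  apply/ler_addgt0Pr => e /ps[N hN]; rewrite add0r.
  apply: le_trans (dd (maxn n N) _).2 (ltW (hN _ _)); first by rewrite leq_maxl.
  by rewrite leq_maxr.
near=> x; rewrite -subr_le0.
have <- : d x = 0 by rewrite d0; exact: (near zeroE x).
by rewrite (near dE x)// le_max lexx.
Unshelve. all: by end_near. Qed.

(** The partial sums of the |v k| are Cauchy and increasing, so that their norm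
    limit exceeds each of them almost everywhere. *)
Lemma riesz_fischer (v : nat -> L0 R) : (forall n, dom X (v n)) ->
  (forall n, nrm X (v n) <= 2^-1 ^+ n) ->
  exists s : L0 R, [/\ dom X s, ncvg X (fun n => \sum_(k < n) absL (v k)) s &
    {ae lebI, forall x, forall n, \sum_(k < n) `|v k x| <= s x}].
Proof.
move=> dv hv.
have da n : dom X (absL (v n)) by have [] := absL_dom (dv n).
have ha n : nrm X (absL (v n)) <= 2^-1 ^+ n by rewrite (absL_dom (dv n)).2.
have ga := geo_cauchy nX da ha.
pose p n : L0 R := \sum_(k < n) absL (v k).
have dp n : dom X (p n) by exact: (dom_sum nX (u := fun k => absL (v k))).
have pE : {ae lebI, forall x, forall n, p n x = \sum_(k < n) `|v k x|}.
  apply: ae_forall => n.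
  have := ae_forall (fun k => absLE (v k)) => aE.
  near=> x; have -> : p n x = \sum_(k < n) L0_fun (absL (v k)) x.
    by near: x; exact: (sumE (fun k => absL (v k)) n).
  by apply: eq_bigr => k _; rewrite (near aE x).
have [||s ds ps] := banach_complete (ideal_banach iX) (u := p) => //.
  move=> e /geo_tail_lt[N hN]; exists N => m n Nm Nn.
  have [nm|/ltnW mn] := leqP n m.
    by apply: le_lt_trans (hN n Nn); exact: ga.
  rewrite nrm_distC//; apply: le_lt_trans (hN m Nm); exact: ga.
exists s; split=> //.
have mono m n : (n <= m)%N -> {ae lebI, forall x, p n x <= p m x}.
  move=> nm; near=> x; rewrite !(near pE x)//.
  rewrite -(subnKC nm) big_split_ord/= lerDl; exact: sumr_ge0.
have ub := ae_forall (ncvg_mono_ub dp ds mono ps).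
by near=> x => n; rewrite -(near pE x)//; exact: (near ub x).
Unshelve. all: by end_near. Qed.

End Ideal.

(** Along a common subsequence u n - a and u n - b are dominated by
    absolutely convergent series, so both tend to 0 almost everywhere. *)
Lemma ideal_compatible X Y : banach_ideal X -> banach_ideal Y ->
  compatible X Y.
Proof.
move=> iX iY u a b du da db.
have nX := banach_normed (ideal_banach iX).
have nY := banach_normed (ideal_banach iY).
have duX n : dom X (u n) by have [] := du n.
have duY n : dom Y (u n) by have [] := du n.
move=> /(ncvgP nX da duX) ua /(ncvgP nY db duY) ub.
have /choice[j hj] : forall n, exists j, nrm X (u j - a) <= 2^-1 ^+ n /\
    nrm Y (u j - b) <= 2^-1 ^+ n.
  move=> n; have n0 : 0 < (2^-1 : R) ^+ n by rewrite exprn_gt0.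
  have [N hN] := ua _ n0; have [N' hN'] := ub _ n0.
  exists (maxn N N').
  by split; apply/ltW; [apply: hN|apply: hN']; rewrite ?leq_maxl ?leq_maxr.
have [||s [ds _ hs]] := riesz_fischer iX (v := fun n => u (j n) - a).
- by move=> n; exact: domB.
- by move=> n; have [] := hj n.
have [||s' [ds' _ hs']] := riesz_fischer iY (v := fun n => u (j n) - b).
- by move=> n; exact: domB.
- by move=> n; have [] := hj n.
have Ea := ae_forall (fun n => subE (u (j n)) a).
have Eb := ae_forall (fun n => subE (u (j n)) b).
apply/L0P; near=> x; apply/eqP; rewrite -subr_eq0 -normr_le0 leNgt; apply/negP => h.
have h1 n : n%:R * `|L0_fun a x - L0_fun b x| <= L0_fun s x + L0_fun s' x.
  have hsx : \sum_(k < n) `|L0_fun (u (j k) - a) x| <= L0_fun s x.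
    by move: n; near: x.
  have hsx' : \sum_(k < n) `|L0_fun (u (j k) - b) x| <= L0_fun s' x.
    by move: n {hsx}; near: x.
  apply: le_trans (lerD hsx hsx').
  rewrite -big_split/= mulr_natl -[n in leLHS]card_ord -sumr_const.
  apply: ler_sum => k _.
  rewrite (near Ea x)// (near Eb x)//.
  rewrite [X in _ <= X + _]distrC; apply: le_trans (ler_normD _ _).
  by rewrite addrA subrK.
pose n := (Num.truncn ((L0_fun s x + L0_fun s' x) / `|L0_fun a x - L0_fun b x|)).+1.
have := h1 n; rewrite -ler_pdivlMr// leNgt => /negP; apply.
exact: truncnS_gt.
Unshelve. all: by end_near. Qed.

End HalfLine.

(** * Kernel operators *)

Lemma ae_eq_integrable d (T : measurableType d) (R : realType)
    (mu : {measure set T -> \bar R}) (D : set T) (f g : T -> \bar R) :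
  measurable D -> measurable_fun D g -> {ae mu, forall x, D x -> f x = g x} ->
  mu.-integrable D f -> mu.-integrable D g.
Proof.
move=> mD mg fg /integrableP[mf fi]; apply/integrableP; split=> //.
rewrite -(ge0_ae_eq_integral (f := fun x => `|f x|%E))//.
- exact: measurableT_comp.
- exact: measurableT_comp.
- by apply: filterS fg => x h /h ->.
Qed.

Section Kernel.
Context {R : realType}.
Local Notation T := (measurableTypeR R).
Local Notation leb := (@lebesgue_measure R).
Local Notation lebI := (@lebI R).
Implicit Types (f g u v : L0 R) (X : nspace (L0 R)).

(** Sets of integration depending measurably on y. Classes are determined only
    on the half-line, hence the second condition. *)
Definition section_family (D : T -> set T) : Prop :=
  measurable [set p : T * T | D p.1 p.2] /\
  forall y t : T, (0 : R) <= y -> D y t -> (0 : R) <= t.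

Variables (D : T -> set T) (sD : section_family D).

Lemma measurable_section y : measurable (D y).
Proof.
have := measurable_xsection y sD.1; rewrite (_ : xsection _ _ = D y)//.
by apply/seteqP; split=> t /=; rewrite /xsection/= inE.
Qed.

Lemma measurable_section_integral (h : T -> \bar R) :
  measurable_fun [set: T] h ->
  measurable_fun [set: T] (fun y => \int[leb]_(t in D y) h t)%E.
Proof.
suff pos (k : T -> \bar R) : measurable_fun [set: T] k -> (forall t, 0 <= k t)%E ->
    measurable_fun [set: T] (fun y => \int[leb]_(t in D y) k t)%E.
  move=> mh; under eq_fun do rewrite integralE.
  by apply: emeasurable_funB; apply: pos => //;
    [exact: measurable_funepos|exact: measurable_funeneg].
move=> mk k0.
pose E := [set p : T * T | D p.1 p.2].
pose K := ((k \o snd) \_ E : T * T -> \bar R).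
have -> : (fun y => \int[leb]_(t in D y) k t)%E =
    (fun y => \int[leb]_t K (y, t))%E.
  apply/funext => y; rewrite integral_mkcond; apply: eq_integral => t _.
  by rewrite /K !patchE; congr (if _ then _ else _); rewrite /E !inE.
apply: (@measurable_fun_fubini_tonelli_F _ _ _ _ _ leb K).
  apply/(measurable_restrictT _ sD.1); apply: measurable_funTS.
  by apply: measurableT_comp => //.
by move=> p; rewrite /K patchE; case: ifP => // _; exact: k0.
Qed.

Lemma ae_section (P : T -> Prop) y : 0 <= y -> {ae lebI, forall t, P t} ->
  {ae leb, forall t, D y t -> P t}.
Proof.
move=> y0 /ae_lebI; apply: filterS => t Pt Dyt; apply: Pt.
exact: sD.2 Dyt.
Qed.

Variables (m k : T -> R).
Hypotheses (mm : measurable_fun [set: T] m) (mk : measurable_fun [set: T] k).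

Definition kernel_integral u (y : T) : \bar R :=
  ((m y)%:E * \int[leb]_(t in D y) (u t * k t)%:E)%E.

Definition kernel_op u : L0 R := xget 0 (represents (kernel_integral u)).

(** No convergence is asked where the outer weight vanishes: the product with
    the integral is 0 there in any case. *)
Definition kernel_adm u : Prop := {ae lebI, forall y : T, m y != 0 ->
  leb.-integrable (D y) (fun t => (u t * k t)%:E)}.

Lemma measurable_mul_kernel u :
  measurable_fun [set: T] (fun t => (u t * k t)%:E : \bar R).
Proof.
by apply/measurable_EFinP; apply: measurable_funM => //; exact: L0_measurable.
Qed.

Lemma kernel_op_represents u : kernel_adm u -> represents (kernel_integral u) (kernel_op u).
Proof.
move=> au; have [g hg] : exists g, represents (kernel_integral u) g.
  apply: represents_ex.
    apply: measurable_funTS; apply: emeasurable_funM; first exact/measurable_EFinP.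
    apply: measurable_section_integral; exact: measurable_mul_kernel.
  near=> y; rewrite /kernel_integral; have [->|my] := eqVneq (m y) 0; first by rewrite mul0e.
  rewrite fin_numM//; apply: integrable_fin_num; first exact: measurable_section.
  by move: my; near: y.
by rewrite /kernel_op (represents_xget hg).
Unshelve. all: by end_near. Qed.

Lemma kernel_op_linear (a : R) u v : kernel_adm u -> kernel_adm v ->
  kernel_adm (a *: u + v) /\ kernel_op (a *: u + v) = a *: kernel_op u + kernel_op v.
Proof.
move=> au av.
have E : {ae lebI, forall t, L0_fun (a *: u + v) t * k t = a * (u t * k t) + v t * k t}.
  near=> t; rewrite (near (addE (a *: u) v) t)// (near (scaleE a u) t)//.
  by rewrite mulrDl mulrA.
have I : {ae lebI, forall y, m y != 0 -> leb.-integrable (D y)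
     (fun t => (a * (u t * k t))%:E + (v t * k t)%:E)%E /\
   (\int[leb]_(t in D y) (L0_fun (a *: u + v) t * k t)%:E =
    a%:E * \int[leb]_(t in D y) (u t * k t)%:E +
    \int[leb]_(t in D y) (v t * k t)%:E)%E}.
  near=> y => my.
  have mDy := measurable_section y.
  have iu : leb.-integrable (D y) (fun t => (u t * k t)%:E) by move: my; near: y.
  have iv : leb.-integrable (D y) (fun t => (v t * k t)%:E).
    by move: my {iu}; near: y.
  have iau : leb.-integrable (D y) (fun t => (a * (u t * k t))%:E).
    by under eq_fun do rewrite EFinM; exact: integrableZl.
  split; first exact: integrableD.
  rewrite (ae_eq_integral (fun t => (a * (u t * k t))%:E + (v t * k t)%:E)%E)//.
  - rewrite integralD//; congr (_ + _)%E.
    by under eq_integral do rewrite EFinM; rewrite integralZl.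
  - by apply: measurable_funTS; exact: measurable_mul_kernel.
  - exact: (measurable_int _ (integrableD mDy iau iv)).
  - have y0 : 0 <= y by near: y; apply: filterS ae_pos => y; exact: ltW.
    by apply: filterS (ae_section y0 E) => t h /h ->; rewrite EFinD.
have auv : kernel_adm (a *: u + v).
  near=> y => my.
  have [iy _] : leb.-integrable (D y) (fun t => (a * (u t * k t))%:E + (v t * k t)%:E)%E /\
   (\int[leb]_(t in D y) (L0_fun (a *: u + v) t * k t)%:E =
    a%:E * \int[leb]_(t in D y) (u t * k t)%:E +
    \int[leb]_(t in D y) (v t * k t)%:E)%E by move: my; near: y.
  have mDy := measurable_section y.
  apply: (ae_eq_integrable mDy _ _ iy).
    by apply: measurable_funTS; exact: measurable_mul_kernel.
  have y0 : 0 <= y by near: y; apply: filterS ae_pos => y; exact: ltW.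
  by apply: filterS (ae_section y0 E) => t h /h ->; rewrite EFinD.
split=> //; apply/L0P; near=> y; apply: EFin_inj.
rewrite (near (kernel_op_represents auv) y)// (near (addE (a *: kernel_op u) (kernel_op v)) y)//.
rewrite (near (scaleE a (kernel_op u)) y)// EFinD EFinM.
rewrite (near (kernel_op_represents au) y)// (near (kernel_op_represents av) y)//.
rewrite /kernel_integral; have [->|my] := eqVneq (m y) 0; first by rewrite !mul0e mule0 adde0.
have mDy := measurable_section y.
have iu : leb.-integrable (D y) (fun t => (u t * k t)%:E) by move: my; near: y.
have iv : leb.-integrable (D y) (fun t => (v t * k t)%:E).
  by move: my {iu}; near: y.
have [_ ->] : leb.-integrable (D y) (fun t => (a * (u t * k t))%:E + (v t * k t)%:E)%E /\
   (\int[leb]_(t in D y) (L0_fun (a *: u + v) t * k t)%:E =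
    a%:E * \int[leb]_(t in D y) (u t * k t)%:E +
    \int[leb]_(t in D y) (v t * k t)%:E)%E by move: my {iu iv}; near: y.
rewrite -(fineK (integrable_fin_num mDy iu)) -(fineK (integrable_fin_num mDy iv)).
by rewrite -!(EFinM, EFinD); congr EFin; ring.
Unshelve. all: by end_near. Qed.

Lemma kernel_op_abs u : kernel_adm u -> {ae lebI, forall y,
  `|kernel_op u y|%:E <= `|m y|%:E * \int[leb]_(t in D y) `|u t * k t|%:E}%E.
Proof.
move=> au; near=> y.
have -> : `|kernel_op u y|%:E = `|kernel_integral u y|%E :> \bar R.
  by rewrite -(near (kernel_op_represents au) y).
rewrite /kernel_integral abseM lee_wpmul2l ?lee_fin//.
apply: le_trans (le_abse_integral _ _ _) _ => //; first exact: measurable_section.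
by apply: measurable_funTS; exact: measurable_mul_kernel.
Unshelve. all: by end_near. Qed.

End Kernel.

(** * Averages *)

Section Cesaro.
Context {R : realType}.
Local Notation T := (measurableTypeR R).
Local Notation leb := (@lebesgue_measure R).
Local Notation lebI := (@lebI R).
Implicit Types (f g u v : L0 R) (X : nspace (L0 R)).

(** The inverse of x is x exp(- ln x^2), also for x = 0. *)
Lemma measurable_invr : measurable_fun [set: T] (fun x : R => x^-1).
Proof.
have -> : (fun x : R => x^-1) = (fun x => x * expR (- ln (x ^+ 2))).
  apply/funext => x; have [->|x0] := eqVneq x 0; first by rewrite invr0 mul0r.
  rewrite expRN lnK ?posrE ?exprn_even_gt0// expr2 invfM mulrA divff//.
  by rewrite mul1r.
apply: measurable_funM => //; apply: measurableT_comp; first exact: measurable_expR.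
apply: measurableT_comp => //.
apply: measurableT_comp; first exact: measurable_ln.
exact: measurable_funX.
Qed.

Definition initial (y : T) : set T := [set` `[(0 : R), y]].

Lemma measurable_le_graph : measurable [set p : T * T | (p.1 : R) <= p.2].
Proof.
have -> : [set p : T * T | (p.1 : R) <= p.2] =
    (fun p : T * T => (p.1 : R) <= p.2) @^-1` [set true].
  by apply/seteqP; split=> p.
rewrite -[X in measurable X]setTI.
have m : measurable_fun setT (fun p : T * T => (p.1 : R) <= p.2).
  by apply: measurable_fun_ler; [exact: measurable_fst|exact: measurable_snd].
exact: m.
Qed.

Lemma initial_section : section_family initial.
Proof.
split; last by move=> y t _; rewrite /initial/= in_itv/= => /andP[].
have -> : [set p : T * T | initial p.1 p.2] =
    (setT `*` @halfline R) `&`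
    ((fun p : T * T => (p.2, p.1)) @^-1` [set p : T * T | (p.1 : R) <= p.2]).
  apply/seteqP; split=> -[y t]; rewrite /initial /halfline/= !in_itv/= andbT.
    by move=> /andP[].
  by move=> [[_ ->] ->].
apply: measurableI.
  by apply: measurableX => //; exact: measurable_halfline.
rewrite -[X in measurable X]setTI.
have m : measurable_fun setT (fun p : T * T => (p.2, p.1)).
  exact: measurable_fun_pair measurable_snd measurable_fst.
exact: (m measurableT _ measurable_le_graph).
Qed.

Lemma measurable_initial y : measurable (initial y).
Proof. exact: measurable_section initial_section y. Qed.

Definition absint f (y : T) : \bar R := (\int[leb]_(t in initial y) `|f t|%:E)%E.

Lemma measurable_absf f : measurable_fun [set: T] (fun t => `|f t|%:E).
Proof.
by apply/measurable_EFinP; apply: measurableT_comp => //; exact: L0_measurable.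
Qed.
Hint Resolve measurable_absf : core.

Lemma absint_ge0 f y : (0 <= absint f y)%E.
Proof. by apply: integral_ge0 => t _; rewrite lee_fin. Qed.

Lemma absint_nondecreasing f (y z : R) : y <= z -> (absint f y <= absint f z)%E.
Proof.
move=> yz; apply: ge0_subset_integral; [exact: measurable_initial..| | |].
- exact: measurable_funTS.
- by move=> t _; rewrite lee_fin.
- by apply: subset_itvl; rewrite bnd_simp.
Qed.

Lemma initial_integrable f y : leb.-integrable (initial y) (EFin \o absf f) <->
  (absint f y < +oo)%E.
Proof.
have E : (\int[leb]_(t in initial y) `|(EFin \o absf f) t| = absint f y)%E.
  by apply: eq_integral => t _; rewrite gee0_abs ?lee_fin /absf.
split=> [/integrableP[_]|fy]; first by rewrite E.
by apply/integrableP; rewrite E; split => //; exact: measurable_funTS (measurable_absf f).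
Qed.

Lemma cesaro_absE f (y : T) :
  Defs.cesaro (absf f) y = (((y : R)^-1)%:E * absint f y)%E.
Proof. by []. Qed.

(** Multiplying by y removes the division, and integrability follows from the
    finiteness of the right-hand side. *)
Lemma cesaro_absP f g : is_cesaro (absf f) g <->
  {ae lebI, forall y : T, absint f y = ((y : R) * g y)%:E}.
Proof.
split=> [[If Rf]|fg].
  near=> y; have y0 : 0 < (y : R) by near: y; exact: ae_pos.
  rewrite EFinM (near Rf y)// cesaro_absE muleA -EFinM divff ?gt_eqF// mul1e.
  by [].
split; near=> y.
  by apply/initial_integrable; rewrite (near fg y)// ltry.
have y0 : 0 < (y : R) by near: y; exact: ae_pos.
rewrite cesaro_absE (near fg y)//.
by rewrite -EFinM mulrA mulVf ?gt_eqF// mul1r.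
Unshelve. all: by end_near. Qed.

Lemma cesaro_uniq f g h : is_cesaro (absf f) g -> is_cesaro (absf f) h -> g = h.
Proof.
move=> [_ fg] [_ fh]; apply: represents_eq fg fh _; exact: aeW.
Qed.

Lemma cesaro_ge0 f g : is_cesaro (absf f) g -> {ae lebI, forall y, 0 <= g y}.
Proof.
move=> /cesaro_absP fg; near=> y.
have y0 : 0 < (y : R) by near: y; exact: ae_pos.
by rewrite -(pmulr_rge0 _ y0) -lee_fin -(near fg y)// absint_ge0.
Unshelve. all: by end_near. Qed.

(** A null set contains no half-line. Finiteness of monotone integrals thus
    passes from almost every y to all y. *)
Lemma ae_unbounded (P : T -> Prop) (y : R) : {ae lebI, forall x, P x} ->
  exists2 z : R, y <= z & P z.
Proof.
move=> aP; apply: contrapT => noz.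
pose a := Num.max y 0.
pose I : set T := [set` `[a, a + 1]].
have [N [mN N0 sN]] : {ae leb, forall x, ~ I x}.
  move/ae_lebI : aP; apply: filterS => x h /=; rewrite /I/= in_itv/= => /andP[ax _].
  apply: noz; exists x; last by apply: h; apply: le_trans ax; rewrite le_max lexx orbT.
  by apply: le_trans ax; rewrite le_max lexx.
have : (leb I <= leb N)%E.
  apply: le_measure; rewrite ?inE//; first exact: measurable_itv.
  by move=> x h; apply: sN => /=; exact.
rewrite N0 lebesgue_measure_itv/= lte_fin ltrDl ltr01 -EFinB lee_fin.
by rewrite addrAC subrr add0r leNgt ltr01.
Qed.

Lemma absint_fin f : {ae lebI, forall y, absint f y < +oo}%E ->
  forall y : R, (absint f y < +oo)%E.
Proof.
move=> h y; have [z yz] := ae_unbounded y h.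
by apply: le_lt_trans; exact: absint_nondecreasing.
Qed.

Lemma cesaro_fin f g : is_cesaro (absf f) g -> forall y : R, (absint f y < +oo)%E.
Proof.
move=> /cesaro_absP fg; apply: absint_fin.
by apply: filterS fg => y ->; rewrite ltry.
Qed.

Lemma cesaro_ex f : {ae lebI, forall y, absint f y < +oo}%E ->
  exists g, is_cesaro (absf f) g.
Proof.
move=> fy; have [g hg] : exists g, represents (Defs.cesaro (absf f)) g.
  apply: represents_ex.
    apply: measurable_funTS; apply: emeasurable_funM.
      by apply/measurable_EFinP; exact: measurable_invr.
    by have := measurable_section_integral initial_section (measurable_absf f).
  near=> y; rewrite cesaro_absE fin_numM// ge0_fin_numE; last exact: absint_ge0.
  by near: y.
exists g; split=> //; apply: filterS fy => y; by move/initial_integrable.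
Unshelve. all: by end_near. Qed.

Lemma absint_ae_le f (h : T -> \bar R) (y : T) :
  measurable_fun [set: T] h -> (forall t, 0 <= h t)%E ->
  {ae lebI, forall t, `|f t|%:E <= h t}%E ->
  (absint f y <= \int[leb]_(t in initial y) h t)%E.
Proof.
move=> mh h0 fh; apply: ae_ge0_le_integral.
- exact: measurable_initial.
- by move=> t _; rewrite lee_fin.
- exact: measurable_funTS.
- by move=> t _; exact: h0.
- exact: measurable_funTS.
- move/ae_lebI : fh; apply: filterS => t h1; rewrite /initial/= in_itv/= => /andP[t0 _].
  exact: h1.
Qed.

(** Monotonicity of the integral, in the form that yields the existence of C|f|
    together with its bound. *)
Lemma cesaro_dominated f (q : L0 R) (h : T -> \bar R) : measurable_fun [set: T] h ->
  (forall t, 0 <= h t)%E -> {ae lebI, forall t, `|f t|%:E <= h t}%E ->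
  {ae lebI, forall y : T, \int[leb]_(t in initial y) h t <= ((y : R) * q y)%:E}%E ->
  exists2 g, is_cesaro (absf f) g & {ae lebI, forall y, 0 <= g y <= q y}.
Proof.
move=> mh h0 fh hq; have le y := absint_ae_le y mh h0 fh.
have [g cg] : exists g, is_cesaro (absf f) g.
  apply: cesaro_ex; apply: filterS hq => y; move/(le_trans (le y)).
  by move/le_lt_trans; apply; rewrite ltry.
exists g => //; have g0 := cesaro_ge0 cg; move/cesaro_absP : cg => cg.
near=> y; have y0 : 0 < (y : R) by near: y; exact: ae_pos.
apply/andP; split; first by near: y.
rewrite -(ler_pM2l y0) -lee_fin -(near cg y)//; apply: le_trans (le y) _.
by near: y.
Unshelve. all: by end_near. Qed.

(** Used with coefficients (1, 0) for the solidity of CX and with (|a|, 1) for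
    its vector space operations. *)
Lemma cesaro_lin f u v g k (a b : R) : 0 <= a -> 0 <= b ->
  is_cesaro (absf u) g -> is_cesaro (absf v) k ->
  {ae lebI, forall t, `|f t| <= a * `|u t| + b * `|v t|} ->
  exists2 h, is_cesaro (absf f) h &
    {ae lebI, forall y, 0 <= h y <= L0_fun (a *: g + b *: k) y}.
Proof.
move=> a0 b0 /cesaro_absP cu /cesaro_absP cv fuv.
have m1 (w : L0 R) (c : R) : measurable_fun [set: T] (fun t => c%:E * `|w t|%:E)%E.
  by apply: emeasurable_funM; [exact: measurable_cst|exact: measurable_absf].
apply: (cesaro_dominated (h := fun t => a%:E * `|u t|%:E + b%:E * `|v t|%:E)%E).
- exact: emeasurable_funD.
- by move=> t; rewrite lee_fin addr_ge0// mulr_ge0.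
- by apply: filterS fuv => t; rewrite lee_fin.
near=> y.
have my := measurable_initial y.
have m2 (w : L0 R) : measurable_fun (initial y) (fun t => `|w t|%:E).
  exact: measurable_funTS (measurable_absf w).
rewrite ge0_integralD//; [|by move=> t _; rewrite lee_fin mulr_ge0
  |exact: measurable_funTS|by move=> t _; rewrite lee_fin mulr_ge0
  |exact: measurable_funTS].
rewrite !ge0_integralZl_EFin//; [|by move=> t _; rewrite lee_fin..].
rewrite -/(absint u y) -/(absint v y) (near cu y)// (near cv y)//.
rewrite (near (addE (a *: g) (b *: k)) y)// (near (scaleE a g) y)//.
rewrite (near (scaleE b k) y)//.
by rewrite -!(EFinM, EFinD) lee_fin mulrDr !(mulrCA y).
Unshelve. all: by end_near. Qed.

Lemma cesaro_scale f g (a : R) : is_cesaro (absf f) g ->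
  is_cesaro (absf (a *: f)) (`|a| *: g).
Proof.
move=> /cesaro_absP fg; apply/cesaro_absP; near=> y.
rewrite (near (scaleE `|a| g) y)// mulrCA EFinM -(near fg y)//.
rewrite /absint -ge0_integralZl_EFin//.
- apply: ge0_ae_eq_integral => //.
  + exact: measurable_initial.
  + exact: measurable_funTS.
  + apply: measurable_funTS; apply: emeasurable_funM; [exact: measurable_cst|exact: measurable_absf].
  + have /ae_lebI := scaleE a f; apply: filterS => t h1.
    rewrite /initial/= in_itv/= => /andP[t0 _].
    by rewrite h1// normrM EFinM.
- exact: measurable_initial.
- exact: measurable_funTS.
Unshelve. all: by end_near. Qed.

Lemma cesaro_eq0 f : is_cesaro (absf f) 0 -> f = 0.
Proof.
move=> cf; have f0 y : absint f y = 0%E.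
  have [z yz] : exists2 z : R, y <= z & absint f z = 0%E.
    apply: ae_unbounded; move/cesaro_absP : cf => cf.
    by near=> z; rewrite (near cf z)// (near zeroE z)// mulr0.
  move=> z0; apply/eqP; rewrite eq_le absint_ge0 andbT -z0.
  exact: absint_nondecreasing.
apply/L0P; apply/ae_lebI.
have h : {ae leb, forall t, forall n : nat, initial n%:R t -> `|f t|%:E = 0 :> \bar R}.
  apply: ae_foralln => n.
  have [+ _] := ae_eq_integral_abs leb (measurable_initial n%:R)
    (measurable_funTS (measurable_absf f)).
  apply; rewrite -[RHS](f0 n%:R); apply: eq_integral => t _.
  by rewrite gee0_abs// lee_fin.
have /ae_lebI z0 := @zeroE R.
near=> t => t0; rewrite (near z0 t)//.
have : `|f t|%:E = 0 :> \bar R.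
  move: (Num.truncn t).+1 (truncnS_gt t) => n tn.
  suff : initial n%:R t by move: n {tn}; near: t.
  by rewrite /initial/= in_itv/= t0 ltW.
by move=> /(congr1 fine) /= /eqP; rewrite normr_eq0 => /eqP.
Unshelve. all: by end_near. Qed.

End Cesaro.

(** * The Cesaro space of a Banach ideal space *)

(** The sum is written as a limit superior because the latter is measurable in
    parameters without any convergence assumption. *)
Lemma series_remainder (R : realType) (a : nat -> R) (N : nat) :
  (\sum_(k <oo) `|a k|%:E < +oo)%E ->
  (`|fine (limn_esup (fun n => (\sum_(k < n) a k)%:E)) - \sum_(k < N) a k|%:E
     <= \sum_(k <oo) `|a (N + k)%N|%:E)%E.
Proof.
move=> Vlt.
have V0 m : (0 <= \sum_(k <oo) `|a (m + k)%N|%:E)%E.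
  by apply: nneseries_ge0 => k _ _; rewrite lee_fin.
have part m n : ((\sum_(k < n) `|a (m + k)%N|)%:E <= \sum_(k <oo) `|a (m + k)%N|%:E)%E.
  rewrite -sumEFin -(big_mkord xpredT (fun k => `|a (m + k)%N|%:E)%E).
  by apply: nneseries_lim_ge => k _ _; rewrite lee_fin.
have /cvg_ex[l Sl] : cvgn (fun n => \sum_(k < n) a k : R^o).
  have -> : (fun n => \sum_(k < n) a k : R^o) = series (a : R^o^nat).
    by apply/funext => n; rewrite /series/= big_mkord.
  apply: normed_cvg; apply: nondecreasing_is_cvgn.
    by apply: nondecreasing_series => k _ _; exact: normr_ge0.
  exists (fine (\sum_(k <oo) `|a k|%:E)) => _ [n _ <-].
  rewrite /normed_series_of /series /= big_mkord -lee_fin fineK; first exact: (part 0%N).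
  by rewrite ge0_fin_numE// (V0 0%N).
have -> : limn_esup (fun n => (\sum_(k < n) a k)%:E) = l%:E.
  by apply: (cvg_limn_einf_sup _).2; apply: cvg_EFin => //; exact: nearW.
have [->|Wlt] := eqVneq (\sum_(k <oo) `|a (N + k)%N|%:E)%E +oo%E; first exact: leey.
have Wfin : (\sum_(k <oo) `|a (N + k)%N|%:E)%E \is a fin_num.
  by rewrite ge0_fin_numE ?V0// ltey.
rewrite -(fineK Wfin) lee_fin /=.
have cN : (fun n => `|\sum_(k < n) a k - \sum_(k < N) a k|) @ \oo -->
    `|l - \sum_(k < N) a k|.
  by apply: cvg_norm; apply: cvgB => //; exact: cvg_cst.
rewrite -(cvg_lim _ cN)//; apply: limr_le; first by apply/cvg_ex; eexists; exact: cN.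
exists N => // n /= Nn.
rewrite -lee_fin fineK//; apply: le_trans (part N (n - N)%N); rewrite lee_fin.
move: (n - N)%N (subnKC Nn) => r <-.
rewrite big_split_ord/= addrAC subrr add0r.
exact: ler_norm_sum.
Qed.

Section CesaroSpace.
Context {R : realType}.
Local Notation T := (measurableTypeR R).
Local Notation leb := (@lebesgue_measure R).
Local Notation lebI := (@lebI R).
Implicit Types (f g u v : L0 R).
Variables (X : nspace (L0 R)) (iX : banach_ideal X).
Let nX := banach_normed (ideal_banach iX).

Lemma CX_nrm f g : is_cesaro (absf f) g -> nrm (CX X) f = nrm X g.
Proof.
move=> cg; rewrite /CX/=; congr (nrm X _).
case: xgetP => [h _ ch|/(_ g)//]; exact: cesaro_uniq ch cg.
Qed.

(** X being solid, it suffices to bound the average by an element of X. *)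
Lemma CX_dominated f g (q : L0 R) : is_cesaro (absf f) g ->
  {ae lebI, forall y, 0 <= g y <= q y} -> dom X q ->
  dom (CX X) f /\ nrm (CX X) f <= nrm X q.
Proof.
move=> cg gq dq; have [dg le] := ideal_le iX gq dq.
by rewrite (CX_nrm cg); split=> //; exists g.
Qed.

Lemma CX_solid f u : {ae lebI, forall x, `|f x| <= `|u x|} ->
  dom (CX X) u -> dom (CX X) f /\ nrm (CX X) f <= nrm (CX X) u.
Proof.
move=> fu [g cg dg]; have [|h ch hg] := cesaro_lin (f := f) ler01 (lexx 0) cg cg.
  by apply: filterS fu => t; rewrite mul1r mul0r addr0.
rewrite (CX_nrm cg) -[g]scale1r -[_ *: g]addr0 -(scale0r g).
by apply: CX_dominated ch hg _; exact: (normed_domP nX _ _ (domZ nX 0 dg)).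
Qed.

Lemma CX_lin (a : R) f u : dom (CX X) f -> dom (CX X) u ->
  dom (CX X) (a *: f + u) /\
  nrm (CX X) (a *: f + u) <= `|a| * nrm (CX X) f + nrm (CX X) u.
Proof.
move=> [g cg dg] [k ck dk].
have [|h ch hg] := cesaro_lin (f := a *: f + u) (normr_ge0 a) ler01 cg ck.
  near=> t; rewrite (near (addE (a *: f) u) t)// (near (scaleE a f) t)//.
  by rewrite mul1r -normrM ler_normD.
have dgk : dom X (`|a| *: g + 1 *: k) by apply: (normed_domP nX) => //; exact: domZ.
have [d le] := CX_dominated ch hg dgk; split=> //; apply: le_trans le _.
apply: le_trans (normed_nrmD nX _ _) _; try exact: domZ.
by rewrite !normed_nrmZ// normr_id normr1 mul1r (CX_nrm cg) (CX_nrm ck).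
Unshelve. all: by end_near. Qed.

Lemma CX_normed : is_normed (CX X).
Proof.
have c0 : is_cesaro (absf (0 : L0 R)) 0.
  have [||||g cg g0] := cesaro_dominated (f := 0 : L0 R) (q := 0 : L0 R)
    (h := cst 0%E : T -> \bar R).
  - exact: measurable_cst.
  - by [].
  - by near=> t; rewrite (near zeroE t)// normr0.
  - by near=> y; rewrite integral0 (near zeroE y)// mulr0.
  suff E : g = 0 by rewrite E in cg.
  apply/L0P; near=> y; have : 0 <= g y <= L0_fun (0 : L0 R) y by near: y.
  by rewrite (near zeroE y)// => h; apply/le_anti; rewrite andbC.
split.
- by exists 0 => //; exact: normed_dom0.
- by move=> a x y dx dy; have [] := CX_lin a dx dy.
- move=> f [g cg dg]; rewrite (CX_nrm cg) => /(normed_eq0 nX dg) g0.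
  by apply: cesaro_eq0; rewrite -g0.
- move=> a f [g cg dg]; rewrite (CX_nrm cg) (CX_nrm (cesaro_scale a cg)).
  by rewrite normed_nrmZ// normr_id.
- move=> f u df du; have [_] := CX_lin 1 df du.
  by rewrite scale1r normr1 mul1r.
Unshelve. all: by end_near. Qed.

Section Completeness.
Variables (v : nat -> L0 R).
Hypotheses (dv : forall n, dom (CX X) (v n))
  (hv : forall n, nrm (CX X) (v n) <= 2^-1 ^+ n).

Let tail (N : nat) (t : T) : \bar R := (\sum_(k <oo) `|v (N + k)%N t|%:E)%E.

Let tail_ge0 N t : (0 <= tail N t)%E.
Proof. by apply: nneseries_ge0 => k _ _; rewrite lee_fin. Qed.

Let measurable_tail N : measurable_fun [set: T] (tail N).
Proof.
apply: (ge0_emeasurable_sum (P := xpredT)) => [k t _ _|k _]; first by rewrite lee_fin.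
exact: measurable_absf.
Qed.

(** The averages of the tails are the tails of the series of averages, which
    converges in X by the Riesz-Fischer property of X. *)
Let averages : exists s : L0 R, dom X s /\ exists p : nat -> L0 R,
  [/\ forall n, dom X (p n), ncvg X p s &
    forall N, {ae lebI, forall y : T,
      \int[leb]_(t in initial y) tail N t <= ((y : R) * L0_fun (s - p N) y)%:E}%E].
Proof.
have /choice[g hg] : forall n, exists g, is_cesaro (absf (v n)) g /\ dom X g.
  by move=> n; have [g] := dv n; exists g.
have cg n : is_cesaro (absf (v n)) (g n) by have [] := hg n.
have dg n : dom X (g n) by have [] := hg n.
have ng n : nrm X (g n) <= 2^-1 ^+ n by rewrite -(CX_nrm (cg n)).
have [s [ds ps hs]] := riesz_fischer iX dg ng.
have da n : dom X (absL (g n)) by have [] := absL_dom iX (dg n).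
exists s; split=> //; exists (fun n => \sum_(k < n) absL (g k)).
split=> // [n|N]; first exact: (dom_sum nX (u := fun k => absL (g k))).
have aE := ae_forall (fun k => absLE (g k)).
have cE : {ae lebI, forall y : T, forall n, absint (v n) y = ((y : R) * g n y)%:E}.
  by apply: ae_forall => n; apply/cesaro_absP.
have SE := sumE (fun k => absL (g k)) N.
near=> y; have y0 : 0 < (y : R) by near: y; exact: ae_pos.
rewrite integral_nneseries; last 3 first.
- exact: measurable_initial.
- by move=> k; apply: measurable_funTS; exact: measurable_absf.
- by move=> k t _; rewrite lee_fin.
apply: lime_le; first by apply: is_cvg_nneseries => k _ _; exact: absint_ge0.
apply: nearW => n; rewrite big_mkord.
have cy k : (\int[leb]_(t in initial y) `|v k t|%:E)%E = ((y : R) * g k y)%:E.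
  by move: k; near: y.
under eq_bigr do rewrite cy.
rewrite sumEFin -mulr_sumr lee_fin ler_pM2l// (near (subE s _) y)// (near SE y)//.
have asy k : L0_fun (absL (g k)) y = `|g k y| by move: k; near: y.
under [X in _ - X]eq_bigr do rewrite asy.
rewrite lerBrDl; apply: le_trans (_ : \sum_(k < N + n) `|g k y| <= _).
  by rewrite big_split_ord/= lerD2l ler_sum// => k _; exact: ler_norm.
by move: (N + n)%N; near: y.
Unshelve. all: by end_near. Qed.

Let tail_fin : {ae lebI, forall t, tail 0 t < +oo}%E.
Proof.
have [s [ds [p [dp ps hp]]]] := averages.
have fin (y : R) : (\int[leb]_(t in initial y) tail 0 t < +oo)%E.
  have [z yz h] := ae_unbounded y (hp 0%N).
  apply: le_lt_trans (le_lt_trans h (ltry _)).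
  apply: ge0_subset_integral; [exact: measurable_initial..| | |].
  - exact: measurable_funTS.
  - by move=> t _; exact: tail_ge0.
  - by apply: subset_itvl; rewrite bnd_simp.
have h : {ae leb, forall t, forall n : nat, initial n%:R t -> tail 0 t \is a fin_num}.
  apply: ae_foralln => n; apply: integrable_ae; first exact: measurable_initial.
  apply/integrableP; split; first exact: measurable_funTS.
  by under eq_integral do rewrite gee0_abs//.
apply/ae_lebI; near=> t => t0.
rewrite -ge0_fin_numE//.
move: (Num.truncn (t : R)).+1 (truncnS_gt (t : R)) => n tn.
suff : initial n%:R t by move: n {tn}; near: t.
by rewrite /initial/= in_itv/= t0 ltW.
Unshelve. all: by end_near. Qed.

(** The series converges pointwise, since its absolute tails have finite
    averages; the remainders of the averages dominate the averages of the
    remainders. *)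
Lemma CX_series : exists2 f, dom (CX X) f &
  ncvg (CX X) (fun n => \sum_(k < n) v k) f.
Proof.
have [s [ds [p [dp ps hp]]]] := averages.
have [f fE] : exists f, {ae lebI, forall t,
    f t = fine (limn_esup (fun n => (\sum_(k < n) v k t)%:E))}.
  apply: L0_ex; apply: measurableT_comp => //; apply: measurable_fun_limn_esup => // n.
  by apply/measurable_EFinP; apply: measurable_sum => k; exact: L0_measurable.
have dist N : dom (CX X) (f - \sum_(k < N) v k) /\
    nrm (CX X) (f - \sum_(k < N) v k) <= nrm X (s - p N).
  have [||||g cg gq] := cesaro_dominated (f := f - \sum_(k < N) v k)
    (q := s - p N) (h := tail N) => //.
    have SE := sumE v N; near=> t.
    rewrite (near (subE f _) t)// (near SE t)// (near fE t)//.
    by apply: (series_remainder (a := fun k => v k t)); near: t; exact: tail_fin.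
  by apply: CX_dominated cg gq _; exact: domB.
have df : dom (CX X) f by have [] := dist 0%N; rewrite big_ord0 subr0.
exists f => //.
have dS n : dom (CX X) (\sum_(k < n) v k) by exact: (dom_sum CX_normed).
apply/ncvgP => //; first exact: CX_normed.
move=> e e0; move/ncvgP : ps => /(_ nX ds dp e e0)[N hN]; exists N => n Nn.
rewrite (nrm_distC CX_normed)//; apply: le_lt_trans (dist n).2 _.
by rewrite (nrm_distC nX)//; exact: hN.
Unshelve. all: by end_near. Qed.

End Completeness.

Lemma CX_ideal : banach_ideal (CX X).
Proof.
split; last exact: CX_solid.
by apply: (banach_of_series CX_normed); exact: CX_series.
Qed.

End CesaroSpace.

(** * The operator from f to C|f| *)

Section SignedAverage.
Context {R : realType}.
Local Notation T := (measurableTypeR R).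
Local Notation leb := (@lebesgue_measure R).
Local Notation lebI := (@lebI R).
Implicit Types (f g u v : L0 R) (X : nspace (L0 R)).

(** This is sgn f: the inverse of 0 being 0, it vanishes with f. *)
Definition phase f (t : T) : R := f t * `|f t|^-1.

Lemma measurable_phase f : measurable_fun [set: T] (phase f).
Proof.
apply: measurable_funM; first exact: L0_measurable.
apply: measurableT_comp; first exact: measurable_invr.
by apply: measurableT_comp => //; exact: L0_measurable.
Qed.

Lemma phase_le1 f t : `|phase f t| <= 1.
Proof.
rewrite /phase normrM normfV normr_id.
by have [->|f0] := eqVneq `|f t| 0; rewrite ?mul0r// divff.
Qed.

Lemma mul_phase f t : f t * phase f t = `|f t|.
Proof.
rewrite /phase mulrA; have [->|f0] := eqVneq (f t) 0; first by rewrite !mul0r normr0.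
by rewrite -expr2 -real_normK ?num_real// expr2 mulfK// normr_eq0.
Qed.

(** The operator u |-> C(sgn(f) u), a linear substitute for u |-> C|u| which
    agrees with it at u = f. *)
Definition signed_average f : L0 R -> L0 R :=
  kernel_op initial (fun y : T => (y : R)^-1) (phase f).

Lemma signed_average_adm f u : (forall y : R, absint u y < +oo)%E ->
  kernel_adm initial (fun y : T => (y : R)^-1) (phase f) u.
Proof.
move=> fu; apply: aeW => y _.
have /initial_integrable := fu y; apply: le_integrable.
- exact: measurable_initial.
- by apply: measurable_funTS; apply: measurable_mul_kernel; exact: measurable_phase.
- move=> t _; rewrite /= lee_fin /absf normr_id normrM.
  by rewrite ler_piMr// phase_le1.
Qed.

Lemma signed_average_self f g : is_cesaro (absf f) g -> signed_average f f = g.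
Proof.
move=> cg; have fin := cesaro_fin cg.
have := kernel_op_represents initial_section measurable_invr (measurable_phase f)
  (signed_average_adm f fin).
move=> /represents_eq; apply; first exact: cg.2.
apply: aeW => y; rewrite /kernel_integral cesaro_absE /absint; congr (_ * _)%E.
by apply: eq_integral => t _; rewrite mul_phase.
Qed.

Lemma signed_average_bounded f X : banach_ideal X ->
  bounded_by 1 (CX X) X (signed_average f).
Proof.
move=> iX u [g cg dg]; rewrite (CX_nrm X cg) mul1r.
apply: ideal_solid => //.
have ha := kernel_op_abs initial_section measurable_invr (measurable_phase f)
  (signed_average_adm f (cesaro_fin cg)).
have [_ rg] := cg; have g0 := cesaro_ge0 cg.
pose m (y : T) : R := (y : R)^-1.
near=> y; rewrite -lee_fin.
have hy : (`|signed_average f u y|%:E <= `|m y|%:E *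
    \int[leb]_(t in initial y) `|L0_fun u t * phase f t|%:E)%E by near: y.
apply: le_trans hy _; rewrite /m.
have y0 : 0 < (y : R) by near: y; exact: ae_pos.
rewrite !ger0_norm ?invr_ge0 ?(ltW y0)//; last by near: y.
rewrite (near rg y)// cesaro_absE; apply: lee_wpmul2l.
  by rewrite lee_fin invr_ge0 ltW.
apply: ge0_le_integral => //.
- exact: measurable_initial.
- apply: measurable_funTS; apply/measurable_EFinP; apply: measurableT_comp => //.
  apply: measurable_funM; [exact: L0_measurable|exact: measurable_phase].
- exact: measurable_funTS (measurable_absf u).
- by move=> t _; rewrite lee_fin normrM ler_piMr// phase_le1.
Unshelve. all: by end_near. Qed.

Lemma CX_nsum_cesaro X0 X1 u : banach_ideal X0 -> banach_ideal X1 ->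
  dom (nsum (CX X0) (CX X1)) u -> exists g, is_cesaro (absf u) g.
Proof.
move=> i0 i1 [u0 [u1 [[g0 c0 _] [g1 c1 _] ->]]].
have [|h ch _] := cesaro_lin (f := u0 + u1) ler01 ler01 c0 c1; last by exists h.
by near=> t; rewrite (near (addE u0 u1) t)// !mul1r ler_normD.
Unshelve. all: by end_near. Qed.

Lemma signed_average_linear f X0 X1 : banach_ideal X0 -> banach_ideal X1 ->
  linear_on (dom (nsum (CX X0) (CX X1))) (signed_average f).
Proof.
move=> i0 i1 a u v /(CX_nsum_cesaro i0 i1)[g cg] /(CX_nsum_cesaro i0 i1)[h ch].
have [_] := kernel_op_linear initial_section measurable_invr (measurable_phase f) a
  (signed_average_adm f (cesaro_fin cg)) (signed_average_adm f (cesaro_fin ch)).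
exact.
Qed.

End SignedAverage.

(** * Points preceded by no mass *)

Section Mass.
Context {R : realType}.
Local Notation T := (measurableTypeR R).
Local Notation leb := (@lebesgue_measure R).
Local Notation lebI := (@lebI R).
Implicit Types (f g u v : L0 R) (X : nspace (L0 R)).

Definition final (y : T) : set T := [set` `[(y : R), +oo[].

Lemma final_section : section_family final.
Proof.
split.
  rewrite (_ : [set p : T * T | _] = [set p : T * T | (p.1 : R) <= p.2]).
    exact: measurable_le_graph.
  by apply/seteqP; split=> -[y t]; rewrite /final/= in_itv/= andbT.
by move=> y t y0; rewrite /final/= in_itv/= andbT; exact: le_trans.
Qed.

Lemma measurable_final y : measurable (final y).
Proof. exact: measurable_section final_section y. Qed.

(** The function A of the outline. Taking real values loses nothing once the
    integrals are finite, see [massK]. *)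
Definition mass f (y : T) : R := fine (absint f y).

Lemma measurable_mass f : measurable_fun [set: T] (mass f).
Proof.
apply: measurableT_comp => //.
exact: measurable_section_integral initial_section _ (measurable_absf f).
Qed.

Lemma mass_ge0 f y : 0 <= mass f y.
Proof. exact/fine_ge0/absint_ge0. Qed.

(** The antiderivative is -1/t. *)
Lemma integral_inv_sqr (y : R) : 0 < y ->
  (\int[leb]_(t in final y) ((t : R)^-1 * (t : R)^-1)%:E = (y^-1)%:E)%E.
Proof.
move=> y0.
have d (x : R) : 0 < x -> is_derive x 1 (fun t : R => - t^-1) (x^-1 * x^-1).
  move=> x0; have x0' : x != 0 by rewrite gt_eqF.
  have dV := @is_deriveV R id x 1 1 x0' (is_derive_id x 1).
  apply: (is_derive_eq (is_deriveN dV)).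
  by rewrite scaleNr opprK -exprVn expr2 /GRing.scale/= mulr1.
rewrite (ge0_continuous_FTC2y (f := fun t => t^-1 * t^-1) (F := fun t => - t^-1) (l := 0)).
- by rewrite sub0e -EFinN opprK.
- by move=> x yx; rewrite mulr_ge0// invr_ge0 (le_trans (ltW y0)).
- apply: continuous_in_subspaceT => x; rewrite inE/= in_itv/= andbT => yx.
  have x0 : x != 0 by rewrite gt_eqF// (lt_le_trans y0).
  by apply: continuousM; exact: inv_continuous.
- rewrite -oppr0; apply: cvgN.
  apply: (gtr0_cvgV0 _).2; last exact: cvg_id.
  exists 0; split => //.
- move=> x yx; have [] // := d x (lt_trans y0 yx).
- apply: cvg_at_right_filter; apply: cvgN; apply: inv_continuous.
  by rewrite gt_eqF.
- move=> x; rewrite in_itv/= andbT => yx; rewrite derive1E.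
  by have [_ ->] := d x (lt_trans y0 yx).
Qed.

Section Finite.
Variables (f : L0 R) (fin : forall y : R, (absint f y < +oo)%E).

Lemma massK y : (mass f y)%:E = absint f y.
Proof. by rewrite /mass fineK// ge0_fin_numE// absint_ge0. Qed.

Lemma mass_le (y z : R) : y <= z -> mass f y <= mass f z.
Proof. by move=> yz; rewrite -lee_fin !massK; exact: absint_nondecreasing. Qed.

(** f vanishes almost everywhere on [0, q] for each rational q with no mass
    before it; the only other point without mass before it is the last one. *)
Lemma mass_gt0 : {ae lebI, forall y, f y != 0 -> 0 < mass f y}.
Proof.
pose q i j : R := i%:R / j.+1%:R.
have fq : {ae leb, forall y, forall i j : nat, mass f (q i j) = 0 ->
    initial (q i j) y -> `|f y|%:E = 0 :> \bar R}.
  apply: ae_foralln => i; apply: ae_foralln => j.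
  have [A0|A0] := eqVneq (mass f (q i j)) 0; last first.
    by apply: aeW => y A1; rewrite A1 eqxx in A0.
  have [+ _] := ae_eq_integral_abs leb (measurable_initial (q i j))
    (measurable_funTS (measurable_absf f)).
  move=> h; have : (\int[leb]_(t in initial (q i j)) `|(`|f t|%:E)| = 0)%E.
    rewrite -[RHS]/(0%:E) -A0 massK; apply: eq_integral => t _.
    by rewrite gee0_abs// lee_fin.
  by move=> /h; apply: filterS => y hy _; exact: hy.
(* points of zero mass which no rational of zero mass exceeds *)
pose B := [set y : R | [/\ 0 <= y, mass f y = 0 & forall i j, mass f (q i j) = 0 ->
  q i j < y]].
have Bsub y z : B y -> B z -> y = z.
  wlog yz : y z / y <= z => [wl|].
    move=> By Bz; have [yz|/ltW zy] := leP y z; first exact: wl.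
    by apply/esym/wl.
  move=> [y0 _ By] [z0 Bz _]; apply/eqP; rewrite eq_le yz/= leNgt; apply/negP => lt.
  pose j := Num.truncn ((z - y)^-1).
  have j0 : 0 < j.+1%:R :> R by [].
  have hj : 1 < (z - y) * j.+1%:R.
    by rewrite mulrC -ltr_pdivrMr ?subr_gt0// div1r truncnS_gt.
  pose i := (Num.truncn (y * j.+1%:R)).+1.
  have yi : y < q i j by rewrite ltr_pdivlMr// truncnS_gt.
  have iz : q i j <= z.
    rewrite ler_pdivrMr// /i -natr1.
    have := truncn_le (y * j.+1%:R); rewrite mulr_ge0// => h.
    by apply: le_trans (lerD h (ltW hj)) _; rewrite -mulrDl addrC subrK.
  have : mass f (q i j) = 0.
    by apply/le_anti; rewrite mass_ge0 andbT -Bz mass_le.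
  by move=> /By; rewrite ltNge (ltW yi).
have [c Bc] : exists c, forall y, B y -> y = c.
  have [[c Bc]|noB] := pselect (exists c, B c); first by exists c => y By; exact: Bsub.
  by exists 0 => y By; exfalso; apply: noB; exists y.
have ac : {ae leb, forall y : T, (y : R) != c}.
  exists [set c]; split; [exact: measurable_set1|exact: lebesgue_measure_set1|].
  by move=> y /= /negP; rewrite negbK => /eqP.
apply/ae_lebI; near=> y => y0 fy; rewrite lt_neqAle mass_ge0 andbT; apply/negP => /eqP A0.
have yc : (y : R) != c by near: y.
apply/(negP yc)/eqP/Bc; split=> // i j Aq; rewrite ltNge; apply/negP => yq.
have : `|f y|%:E = 0 :> \bar R.
  have : initial (q i j) y by rewrite /initial/= in_itv/= y0.
  by move: i j Aq {yq}; near: y.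
by move=> /(congr1 fine)/= /eqP; rewrite normr_eq0 (negbTE fy).
Unshelve. all: by end_near. Qed.

End Finite.

End Mass.

(** * The operator from C|f| to f *)

Section Spread.
Context {R : realType}.
Local Notation T := (measurableTypeR R).
Local Notation leb := (@lebesgue_measure R).
Local Notation lebI := (@lebI R).
Implicit Types (g u v : L0 R) (X : nspace (L0 R)).

Variables (f : L0 R) (fin : forall y : R, (absint f y < +oo)%E).

Definition spread_weight (y : T) : R := (y : R) * f y.

(** Where there is no mass before t the inverse is 0; by [mass_gt0] the weight
    vanishes almost everywhere on this set as well. *)
Definition spread_kernel (t : T) : R := ((t : R) * mass f t)^-1.
Definition spread : L0 R -> L0 R := kernel_op final spread_weight spread_kernel.

Local Notation m := spread_weight.
Local Notation k := spread_kernel.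

Lemma measurable_spread_weight : measurable_fun [set: T] m.
Proof. by apply: measurable_funM => //; exact: L0_measurable. Qed.

Lemma measurable_spread_kernel : measurable_fun [set: T] k.
Proof.
apply: measurableT_comp; first exact: measurable_invr.
by apply: measurable_funM => //; exact: measurable_mass.
Qed.

Definition copson_absint g (y : T) : \bar R :=
  (\int[leb]_(t in final y) `|g t / (t : R)|%:E)%E.

Lemma measurable_copson_integrand g :
  measurable_fun [set: T] (fun t : T => `|g t / (t : R)|%:E : \bar R).
Proof.
apply/measurable_EFinP; apply: measurableT_comp => //.
by apply: measurable_funM; [exact: L0_measurable|exact: measurable_invr].
Qed.

Lemma mul_kernel_mass (s : R) : 0 <= s -> `|k s| * mass f s <= s^-1.
Proof.
move=> s0; have m0 := mass_ge0 f s.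
rewrite ger0_norm ?invr_ge0 ?mulr_ge0// /k invfM -mulrA.
have [->|A0] := eqVneq (mass f s) 0; first by rewrite mulr0 mulr0 invr_ge0.
by rewrite mulVf// mulr1.
Qed.

Let graph (y : R) := [set p : T * T | initial y p.1 /\ (p.1 : R) <= p.2].

Let K (g : L0 R) (y : R) : T * T -> \bar R :=
  (fun p : T * T => (`|m p.1| * `|g p.2 * k p.2|)%:E) \_ (graph y).

Let graph_measurable y : measurable (graph y).
Proof.
have -> : graph y = (initial y `*` setT) `&` [set p : T * T | (p.1 : R) <= p.2].
  by apply/seteqP; split=> -[t s] /= [] // [].
apply: measurableI; last exact: measurable_le_graph.
by apply: measurableX => //; exact: measurable_initial.
Qed.

Let K_measurable g y : measurable_fun [set: T * T] (K g y).
Proof.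
apply/(measurable_restrictT _ (graph_measurable y)); apply: measurable_funTS.
apply/measurable_EFinP; apply: measurable_funM.
  apply: measurableT_comp => //; apply: measurableT_comp => //.
  exact: measurable_spread_weight.
apply: measurableT_comp => //; apply: measurable_funM.
  by apply: measurableT_comp => //; exact: L0_measurable.
by apply: measurableT_comp => //; exact: measurable_spread_kernel.
Qed.

Let K_ge0 g y p : (0 <= K g y p)%E.
Proof. by rewrite /K patchE; case: ifP => // _; rewrite lee_fin mulr_ge0. Qed.

(** For fixed s the integral over t of |t f(t)| is at most min(y, s) times the
    mass before s, which the kernel cancels up to the factor 1/s. *)
Let K_section g y (s : T) : 0 <= y ->
  (\int[leb]_t K g y (t, s) <= ((fun s => `|g s|%:E) \_ (initial y)) s +
     ((fun s : T => (y * `|g s / (s : R)|)%:E) \_ (final y)) s)%E.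
Proof.
move=> y0.
have r1 : (0 <= ((fun s => `|g s|%:E) \_ (initial y)) s)%E.
  by rewrite patchE; case: ifP => // _; rewrite lee_fin.
have r2 : (0 <= ((fun s : T => (y * `|g s / (s : R)|)%:E) \_ (final y)) s)%E.
  by rewrite patchE; case: ifP => // _; rewrite lee_fin mulr_ge0.
have [s0|s0] := ltP (s : R) 0.
  rewrite integral0_eq ?adde_ge0// => t _; rewrite /K patchE ifF//.
  apply/negbTE/negP; rewrite inE /graph/= => -[].
  rewrite /initial/= in_itv/= => /andP[t0 _] ts.
  by have := le_lt_trans (le_trans t0 ts) s0; rewrite ltxx.
pose z := Num.min y (s : R).
have z0 : 0 <= z by rewrite /z le_min y0.
pose c := z * `|g s * k s|.
have c0 : 0 <= c by rewrite mulr_ge0.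
apply: le_trans (_ : c%:E * absint f z <= _)%E.
  rewrite /absint -ge0_integralZl_EFin//; last first.
  - exact: measurable_funTS (measurable_absf f).
  - exact: measurable_initial.
  rewrite [leRHS]integral_mkcond; apply: ge0_le_integral => //.
  - by apply: measurableT_comp; [exact: K_measurable|exact: measurable_pair2].
  - apply/(measurable_restrictT _ (measurable_initial z)); apply: measurable_funTS.
    by apply: emeasurable_funM; [exact: measurable_cst|exact: measurable_absf].
  - move=> t _; rewrite /K !patchE; case: ifPn => [|_]; last first.
      by case: ifP => // _; rewrite lee_fin mulr_ge0.
    rewrite inE /graph/= /initial/= in_itv/= => -[/andP[t0 ty] ts].
    have tz : (t : R) <= z by rewrite /z le_min ty.
    rewrite ifT ?inE/= ?in_itv/= ?t0//.
    rewrite -EFinM lee_fin /c /m normrM (ger0_norm t0) -!mulrA.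
    by rewrite [X in z * X]mulrC ler_pM// mulr_ge0.
rewrite -massK// -EFinM.
have zs : z <= s by rewrite /z ge_min lexx orbT.
apply: le_trans (_ : (z * `|g s / (s : R)|)%:E <= _)%E.
  rewrite lee_fin /c -mulrA ler_wpM2l// !normrM -mulrA ler_wpM2l//.
  rewrite [leRHS]ger0_norm ?invr_ge0//.
  apply: le_trans (mul_kernel_mass s0); rewrite ler_wpM2l//.
  exact: mass_le.
have [sy|/ltW ys] := leP (s : R) y.
  have -> : z = s by rewrite /z; exact/min_idPr.
  apply: le_trans (_ : `|g s|%:E <= _)%E; last first.
    rewrite !patchE ifT ?inE/initial/= ?in_itv/= ?s0 ?sy//.
    by rewrite -[leLHS]adde0 leeD2l// -patchE.
  rewrite lee_fin normrM normfV (ger0_norm s0) mulrCA.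
  have [->|sn0] := eqVneq (s : R) 0; first by rewrite mul0r mulr0.
  by rewrite divff// mulr1.
have -> : z = y by rewrite /z; exact/min_idPl.
rewrite [X in (_ <= _ + X)%E]patchE ifT ?inE/final/= ?in_itv/= ?ys//.
by rewrite -[leLHS]add0e leeD2r.
Qed.

(** By [K_section], the part s <= y of the exchanged integral gives the integral
    of |g| and the part s >= y gives y times that of |g| / s. *)
Lemma spread_tonelli g (y : T) : (0 : R) <= y ->
  (\int[leb]_(t in initial y) (`|m t|%:E * \int[leb]_(s in final t) `|g s * k s|%:E)
    <= absint g y + (y : R)%:E * copson_absint g y)%E.
Proof.
move=> y0.
have mgk : measurable_fun [set: T] (fun s => `|g s * k s|%:E).
  apply/measurable_EFinP; apply: measurableT_comp => //; apply: measurable_funM.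
    exact: L0_measurable.
  exact: measurable_spread_kernel.
have -> : (\int[leb]_(t in initial y)
      (`|m t|%:E * \int[leb]_(s in final t) `|g s * k s|%:E) =
    \int[leb]_t \int[leb]_s K g y (t, s))%E.
  rewrite integral_mkcond; apply: eq_integral => t _; rewrite patchE.
  case: ifPn => [ty|ty]; last first.
    rewrite integral0_eq// => s _; rewrite /K patchE ifF//.
    apply/negbTE/negP; rewrite inE => -[] /=.
    by move: ty => /negP h /mem_set /h.
  rewrite -ge0_integralZl_EFin//; last 2 first.
  - exact: measurable_final.
  - exact: measurable_funTS.
  rewrite integral_mkcond; apply: eq_integral => s _.
  rewrite /K !patchE EFinM; congr (if _ then _ else _).
  apply/idP/idP; rewrite !inE /graph/= /final/= in_itv/= andbT.
    by move=> ts; split=> //; exact: set_mem ty.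
  by case.
rewrite -/(fubini_F leb (K g y)).
rewrite (fubini_tonelli (m1 := leb) (m2 := leb) (K g y)) => //.
have mi : measurable_fun [set: T] ((fun s => `|g s|%:E) \_ (initial y)).
  apply/(measurable_restrictT _ (measurable_initial y)); apply: measurable_funTS.
  exact: measurable_absf.
have mf : measurable_fun [set: T] ((fun s : T => ((y : R) * `|g s / (s : R)|)%:E) \_ (final y)).
  apply/(measurable_restrictT _ (measurable_final y)); apply: measurable_funTS.
  under eq_fun do rewrite EFinM.
  by apply: emeasurable_funM; [exact: measurable_cst|exact: measurable_copson_integrand].
have i0 s : (0 <= ((fun s => `|g s|%:E) \_ (initial y)) s)%E.
  by rewrite patchE; case: ifP => // _; rewrite lee_fin.
have f0 s : (0 <= ((fun s : T => ((y : R) * `|g s / (s : R)|)%:E) \_ (final y)) s)%E.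
  by rewrite patchE; case: ifP => // _; rewrite lee_fin mulr_ge0.
apply: le_trans (ge0_le_integral leb measurableT _ _ _ (fun s _ => K_section g s y0)) _.
- by move=> s _; apply: integral_ge0.
- by apply: measurable_fun_fubini_tonelli_G.
- exact: emeasurable_funD.
rewrite ge0_integralD// -!integral_mkcond.
under [X in (_ + X <= _)%E]eq_integral do rewrite EFinM.
rewrite ge0_integralZl_EFin//; first exact: measurable_final.
exact: measurable_funTS (measurable_copson_integrand g).
Qed.

(** On [y, oo) the kernel is at most 1 / (t A(y)), because A increases. *)
Lemma spread_adm g : {ae lebI, forall y, copson_absint g y < +oo}%E -> kernel_adm final m k g.
Proof.
move=> gfin; near=> y => my.
have y0 : 0 < (y : R) by near: y; exact: ae_pos.
have fy : f y != 0 by apply: contra_neq my => fy; rewrite /m fy mulr0.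
have A0 : 0 < mass f y by move: fy; near: y; exact: mass_gt0.
have ig : leb.-integrable (final y) (fun t : T => (g t / (t : R))%:E).
  apply/integrableP; split.
    apply: measurable_funTS; apply/measurable_EFinP.
    by apply: measurable_funM; [exact: L0_measurable|exact: measurable_invr].
  rewrite (_ : (\int[leb]_(t in final y) _)%E = copson_absint g y); first by near: y.
  by apply: eq_integral.
apply: (le_integrable _ _ _ (integrableZl (measurable_final y) (mass f y)^-1 ig)).
- exact: measurable_final.
- by apply: measurable_funTS; apply: measurable_mul_kernel; exact: measurable_spread_kernel.
- move=> t; rewrite /final/= in_itv/= andbT => yt.
  have t0 : 0 < (t : R) := lt_le_trans y0 yt.
  have At : mass f y <= mass f t by exact: mass_le.
  have At0 : 0 < mass f t := lt_le_trans A0 At.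
  rewrite lee_fin /k invfM mulrA mulrC !normrM.
  apply: ler_wpM2r; first exact: mulr_ge0.
  by rewrite !gtr0_norm ?invr_gt0// lef_pV2.
Unshelve. all: by end_near. Qed.

(** For g = C|f| the integrand g(t) / (t A(t)) is t^-2 on [y, oo) as soon as
    A(y) > 0, and its integral 1/y cancels the weight. *)
Lemma spread_self g : is_cesaro (absf f) g ->
  {ae lebI, forall y, copson_absint g y < +oo}%E -> spread g = f.
Proof.
move=> /cesaro_absP cg gfin; apply/L0P.
have rep := kernel_op_represents final_section measurable_spread_weight
  measurable_spread_kernel (spread_adm gfin).
near=> y; apply: EFin_inj; rewrite (near rep y)// /kernel_integral.
have y0 : 0 < (y : R) by near: y; exact: ae_pos.
have [fy|fy] := eqVneq (f y) 0; first by rewrite /m fy mulr0 mul0e.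
have A0 : 0 < mass f y by move: fy; near: y; exact: mass_gt0.
rewrite (_ : (\int[leb]_(t in final y) _)%E = ((y : R)^-1)%:E).
  by rewrite /m -EFinM mulrAC divff ?gt_eqF// mul1r.
rewrite -(integral_inv_sqr y0); apply: ae_eq_integral.
- exact: measurable_final.
- by apply: measurable_funTS; apply: measurable_mul_kernel; exact: measurable_spread_kernel.
- apply: measurable_funTS; apply/measurable_EFinP.
  by apply: measurable_funM; exact: measurable_invr.
apply: filterS (ae_section final_section (ltW y0) cg) => t h yt.
have At : mass f t = (t : R) * g t by apply: EFin_inj; rewrite massK// h.
move: yt; rewrite /final/= in_itv/= andbT => yt.
congr EFin.
have t0 : 0 < (t : R) := lt_le_trans y0 yt.
have At0 : 0 < mass f t := lt_le_trans A0 (mass_le fin yt).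
have gt : g t != 0.
  by apply: contraTneq At0 => g0; rewrite At g0 mulr0 ltxx.
by rewrite /k At; field; rewrite gt gt_eqF.
Unshelve. all: by end_near. Qed.

(** Division of [spread_tonelli] by y. *)
Lemma spread_cesaro g c (h : L0 R) : is_cesaro (absf g) c ->
  {ae lebI, forall y, copson_absint g y = (h y)%:E} ->
  exists2 q, is_cesaro (absf (spread g)) q &
    {ae lebI, forall y, 0 <= q y <= L0_fun (c + h) y}.
Proof.
move=> /cesaro_absP cg hg.
have gfin : {ae lebI, forall y, copson_absint g y < +oo}%E.
  by apply: filterS hg => y ->; rewrite ltry.
have mgk : measurable_fun [set: T] (fun s => `|g s * k s|%:E).
  apply/measurable_EFinP; apply: measurableT_comp => //; apply: measurable_funM.
    exact: L0_measurable.
  exact: measurable_spread_kernel.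
apply: (cesaro_dominated (h := fun t =>
   (`|m t|%:E * \int[leb]_(s in final t) `|g s * k s|%:E)%E)).
- apply: emeasurable_funM; last exact: measurable_section_integral final_section _ mgk.
  apply/measurable_EFinP; apply: measurableT_comp => //.
  exact: measurable_spread_weight.
- by move=> t; apply: mule_ge0 => //; apply: integral_ge0 => s _; rewrite lee_fin.
- have := kernel_op_abs final_section measurable_spread_weight
    measurable_spread_kernel (spread_adm gfin); exact.
near=> y; have y0 : 0 < (y : R) by near: y; exact: ae_pos.
apply: le_trans (spread_tonelli g (ltW y0)) _.
rewrite (near cg y)// (near hg y)// (near (addE c h) y)//.
by rewrite -EFinM -EFinD lee_fin mulrDr.
Unshelve. all: by end_near. Qed.

End Spread.

Section SpreadBounded.
Context {R : realType}.
Local Notation T := (measurableTypeR R).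
Local Notation leb := (@lebesgue_measure R).
Local Notation lebI := (@lebI R).
Implicit Types (f g u v : L0 R).

Lemma is_cesaro_absL g c : is_cesaro (absL g) c -> is_cesaro (absf g) c.
Proof.
move=> [_ rc]; apply/cesaro_absP; near=> y.
have y0 : 0 < (y : R) by near: y; exact: ae_pos.
rewrite EFinM (near rc y)// /Defs.cesaro muleA -EFinM divff ?gt_eqF// mul1e.
apply: ae_eq_integral.
- exact: measurable_initial.
- exact: measurable_funTS (measurable_absf g).
- by apply: measurable_funTS; apply/measurable_EFinP; exact: L0_measurable.
apply: filterS (ae_section initial_section (ltW y0) (absLE g)) => t h yt.
by rewrite h.
Unshelve. all: by end_near. Qed.

Lemma is_copson_absL g h : is_copson (absL g) h ->
  {ae lebI, forall y, copson_absint g y = (h y)%:E}.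
Proof.
move=> [_ rh]; near=> y.
have y0 : 0 < (y : R) by near: y; exact: ae_pos.
rewrite (near rh y)//; apply: ae_eq_integral.
- exact: measurable_final.
- exact: measurable_funTS (measurable_copson_integrand g).
- apply: measurable_funTS; apply/measurable_EFinP.
  by apply: measurable_funM; [exact: L0_measurable|exact: measurable_invr].
apply: filterS (ae_section final_section (ltW y0) (absLE g)) => t h1 yt.
have t0 : 0 <= (t : R) by move: yt; rewrite /final/= in_itv/= andbT; exact: le_trans (ltW y0).
by rewrite h1// normrM (ger0_norm (x := _^-1)) ?invr_ge0.
Unshelve. all: by end_near. Qed.

Section Space.
Variables (X : nspace (L0 R)) (iX : banach_ideal X).
Hypotheses (hC : bounded_on X is_cesaro) (hCs : bounded_on X is_copson).
Let nX := banach_normed (ideal_banach iX).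

Lemma copson_absint_fin g : dom X g -> {ae lebI, forall y, copson_absint g y < +oo}%E.
Proof.
move=> dg; have [M hM] := hCs; have [dag _] := absL_dom iX dg.
have [h [/is_copson_absL ch _ _]] := hM _ dag.
by apply: filterS ch => y ->; rewrite ltry.
Qed.

Lemma spread_bounded : exists M, forall f,
  (forall y : R, absint f y < +oo)%E -> bounded_by M X (CX X) (spread f).
Proof.
have [M hM] := hC; have [M' hM'] := hCs; exists (M + M') => f fin g dg.
have [dag nag] := absL_dom iX dg.
have [c [/is_cesaro_absL cc dc lc]] := hM _ dag.
have [h [/is_copson_absL ch dh lh]] := hM' _ dag.
have [q cq qch] := spread_cesaro fin cc ch.
have [d le] := CX_dominated iX cq qch (domD nX dc dh); split=> //.
apply: le_trans le _; apply: le_trans (normed_nrmD nX dc dh) _.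
by rewrite mulrDl -nag lerD.
Qed.

End Space.

Lemma copson_absint_nsum X0 X1 g : banach_ideal X0 -> banach_ideal X1 ->
  bounded_on X0 is_copson -> bounded_on X1 is_copson ->
  dom (nsum X0 X1) g -> {ae lebI, forall y, copson_absint g y < +oo}%E.
Proof.
move=> i0 i1 h0 h1 [g0 [g1 [d0 d1 ->]]].
have f0 := copson_absint_fin i0 h0 d0; have f1 := copson_absint_fin i1 h1 d1.
near=> y.
have y0 : 0 < (y : R) by near: y; exact: ae_pos.
apply: le_lt_trans (_ : copson_absint g0 y + copson_absint g1 y < _)%E.
  rewrite /copson_absint -ge0_integralD//; last 3 first.
  - exact: measurable_final.
  - exact: measurable_funTS (measurable_copson_integrand g0).
  - exact: measurable_funTS (measurable_copson_integrand g1).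
  apply: ae_ge0_le_integral => //.
  - exact: measurable_final.
  - exact: measurable_funTS (measurable_copson_integrand _).
  - by move=> t _; rewrite -EFinD lee_fin addr_ge0.
  - apply: emeasurable_funD; exact: measurable_funTS (measurable_copson_integrand _).
  apply: filterS (ae_section final_section (ltW y0) (addE g0 g1)) => t h yt.
  by rewrite h// mulrDl lee_fin ler_normD.
by rewrite lte_add_pinfty//; near: y.
Unshelve. all: by end_near. Qed.

Lemma spread_linear f X0 X1 : (forall y : R, absint f y < +oo)%E ->
  banach_ideal X0 -> banach_ideal X1 ->
  bounded_on X0 is_copson -> bounded_on X1 is_copson ->
  linear_on (dom (nsum X0 X1)) (spread f).
Proof.
move=> fin i0 i1 h0 h1 a u v du dv.
have := kernel_op_linear final_section (measurable_spread_weight f)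
  (measurable_spread_kernel f) a
  (spread_adm fin (copson_absint_nsum i0 i1 h0 h1 du))
  (spread_adm fin (copson_absint_nsum i0 i1 h0 h1 dv)).
by case.
Qed.

End SpreadBounded.

(** * The two interpolation formulas *)

Lemma bounded_by_le (R : realType) (V W : lmodType R) (M M' : R)
    (Y : nspace V) (Z : nspace W) (T : V -> W) : is_normed Y -> M <= M' ->
  bounded_by M Y Z T -> bounded_by M' Y Z T.
Proof.
move=> nY MM' bT x dx; have [d le] := bT x dx; split=> //.
by apply: le_trans le _; rewrite ler_wpM2r// nrm_ge0.
Qed.

Lemma Kfun_bounded_by (R : realType) (V W : lmodType R) (Y0 Y1 : nspace V)
    (Z0 Z1 : nspace W) (M : R) (T : V -> W) :
  is_normed Y0 -> is_normed Y1 -> is_normed Z0 -> is_normed Z1 -> 0 < M ->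
  linear_on (dom (nsum Y0 Y1)) T ->
  bounded_by M Y0 Z0 T -> bounded_by M Y1 Z1 T ->
  forall x, dom (nsum Y0 Y1) x -> dom (nsum Z0 Z1) (T x) /\
    forall t, 0 <= t -> Kfun Z0 Z1 t (T x) <= M * Kfun Y0 Y1 t x.
Proof.
move=> n0 n1 m0 m1 M0 lT b0 b1 x dx.
have TD x0 x1 : dom Y0 x0 -> dom Y1 x1 -> T (x0 + x1) = T x0 + T x1.
  move=> d0 d1; rewrite -{1}[x0]scale1r lT ?scale1r//; first exact: nsum_l.
  exact: nsum_r.
split=> [|t t0].
  have [x0 [x1 [d0 d1 ->]]] := dx; exists (T x0), (T x1); split.
  - by have [] := b0 _ d0.
  - by have [] := b1 _ d1.
  - exact: TD.
rewrite -ler_pdivrMl//; apply: Kfun_lub => // x0 x1 d0 d1 ->.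
have [e0 l0] := b0 _ d0; have [e1 l1] := b1 _ d1.
rewrite ler_pdivrMl// TD//; apply: le_trans (Kfun_le m0 m1 t0 e0 e1) _.
by rewrite mulrDr mulrCA lerD// ler_wpM2l.
Qed.

Section KMethod.
Context {R : realType}.
Local Notation T := (measurableTypeR R).
Local Notation lebI := (@lebI R).

(** The K-functional is nondecreasing in t, hence measurable. *)
Lemma Kfun_represents (V : lmodType R) (Y0 Y1 : nspace V) x :
  is_normed Y0 -> is_normed Y1 -> dom (nsum Y0 Y1) x ->
  exists k, represents (fun t => (Kfun Y0 Y1 t x)%:E) k.
Proof.
move=> n0 n1 dx; apply: represents_ex; last exact: aeW.
apply/measurable_EFinP.
apply: (eq_measurable_fun (fun t : R => Kfun Y0 Y1 (Num.max t 0) x)).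
  move=> t; rewrite inE /halfline/= in_itv/= andbT => t0.
  by congr (Kfun _ _ _ _); exact/max_idPl.
apply: nondecreasing_measurable; first exact: measurable_halfline.
move=> s t st; apply: Kfun_nondecreasing => //; first by rewrite le_max lexx orbT.
by rewrite ge_max !le_max st lexx orbT.
Qed.

Lemma Kmethod_le (V W : lmodType R) (Y0 Y1 : nspace V) (Z0 Z1 : nspace W)
    (G : nspace (L0 R)) (M : R) x z :
  is_normed Z0 -> is_normed Z1 -> banach_ideal G -> 0 < M ->
  dom (nsum Z0 Z1) z ->
  (forall t, 0 <= t -> Kfun Z0 Z1 t z <= M * Kfun Y0 Y1 t x) ->
  dom (Kmethod G Y0 Y1) x ->
  dom (Kmethod G Z0 Z1) z /\
  nrm (Kmethod G Z0 Z1) z <= M * nrm (Kmethod G Y0 Y1) x.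
Proof.
move=> n0 n1 iG M0 dz le [dx [k rk dk]].
have nG := banach_normed (ideal_banach iG).
have [k' rk'] := Kfun_represents n0 n1 dz.
have [dk' lk'] : dom G k' /\ nrm G k' <= nrm G (M *: k).
  apply: (ideal_le iG); last exact: domZ.
  near=> t; have t0 : 0 <= (t : R) by apply: ltW; near: t; exact: ae_pos.
  rewrite (near (scaleE M k) t)//.
  have -> : k t = Kfun Y0 Y1 t x by apply: EFin_inj; near: t.
  have -> : k' t = Kfun Z0 Z1 t z by apply: EFin_inj; near: t.
  by rewrite le// andbT; exact: Kfun_ge0.
rewrite /Kmethod/= (represents_xget rk) (represents_xget rk'); split.
  by split=> //; exists k'.
by rewrite (normed_nrmZ nG) ?gtr0_norm in lk'.
Unshelve. all: by end_near. Qed.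

End KMethod.

Theorem theorem6 (R : realType) (X0 X1 : nspace (L0 R))
    (hX0 : banach_function_space X0) (hX1 : banach_function_space X1)
    (hC0 : bounded_on X0 is_cesaro) (hC1 : bounded_on X1 is_cesaro)
    (hCs0 : bounded_on X0 is_copson) (hCs1 : bounded_on X1 is_copson) :
  (forall F : couple_map R,
     interpolation_functor F -> homogeneous_on F X0 X1 ->
     nequiv (F (L0 R) (CX X0) (CX X1)) (CX (F (L0 R) X0 X1))) /\
  (forall G : nspace (L0 R),
     banach_ideal G -> contains_min1 G ->
     nequiv (Kmethod G (CX X0) (CX X1)) (CX (Kmethod G X0 X1))).
Proof.
have i0 := bfs_ideal hX0; have i1 := bfs_ideal hX1.
have c0 := CX_ideal i0; have c1 := CX_ideal i1.
have n0 := banach_normed (ideal_banach i0).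
have n1 := banach_normed (ideal_banach i1).
have m0 := banach_normed (ideal_banach c0).
have m1 := banach_normed (ideal_banach c1).
have cX := ideal_compatible i0 i1; have cC := ideal_compatible c0 c1.
have [M [M1 hM0 hM1]] : exists M, [/\ 1 <= M,
    forall f, (forall y : R, absint f y < +oo)%E -> bounded_by M X0 (CX X0) (spread f) &
    forall f, (forall y : R, absint f y < +oo)%E -> bounded_by M X1 (CX X1) (spread f)].
  have [A hA] := spread_bounded i0 hC0 hCs0.
  have [B hB] := spread_bounded i1 hC1 hCs1.
  exists (Num.max 1 (Num.max A B)); split; first by rewrite le_max lexx.
    move=> f fin; apply: (bounded_by_le n0 _ (hA f fin)).
    by rewrite !le_max lexx orbT.
  move=> f fin; apply: (bounded_by_le n1 _ (hB f fin)).
  by rewrite !le_max lexx !orbT.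
have M0 : 0 < M := lt_le_trans ltr01 M1.
have bS0 f : bounded_by M (CX X0) X0 (signed_average f).
  exact: bounded_by_le m0 M1 (signed_average_bounded f i0).
have bS1 f : bounded_by M (CX X1) X1 (signed_average f).
  exact: bounded_by_le m1 M1 (signed_average_bounded f i1).
have lS f := signed_average_linear f i0 i1.
have lT f (fin : forall y : R, (absint f y < +oo)%E) := spread_linear fin i0 i1 hCs0 hCs1.
have spreadK f g : is_cesaro (absf f) g -> dom (nsum X0 X1) g -> spread f g = f.
  move=> cg dg; have fin := cesaro_fin cg.
  have gfin := copson_absint_nsum i0 i1 hCs0 hCs1 dg.
  exact: (spread_self fin cg gfin).
split=> [F fF _|G iG _].
- have [a ha] := interp_uniform M fF (ideal_banach c0) (ideal_banach c1) cC
    (ideal_banach i0) (ideal_banach i1) cX.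
  have [b hb] := interp_uniform M fF (ideal_banach i0) (ideal_banach i1) cX
    (ideal_banach c0) (ideal_banach c1) cC.
  have CC := compatible_couple (ideal_banach c0) (ideal_banach c1) cC.
  have CP := compatible_couple (ideal_banach i0) (ideal_banach i1) cX.
  have [? sumC] := interp_sum fF CC; have [? sumX] := interp_sum fF CP.
  have nFC := banach_normed (interp_banach fF CC).
  have nFX := banach_normed (interp_banach fF CP).
  have fwd f : dom (F _ (CX X0) (CX X1)) f ->
      dom (CX (F _ X0 X1)) f /\
      nrm (CX (F _ X0 X1)) f <= a * nrm (F _ (CX X0) (CX X1)) f.
    move=> df; have [g cg] := CX_nsum_cesaro i0 i1 (proj1 (sumC f df)).
    have [dg lg] := ha _ (lS f) (bS0 f) (bS1 f) _ df.
    rewrite (signed_average_self cg) in dg lg.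
    by rewrite (CX_nrm _ cg); split=> //; exists g.
  have bwd f : dom (CX (F _ X0 X1)) f ->
      dom (F _ (CX X0) (CX X1)) f /\
      nrm (F _ (CX X0) (CX X1)) f <= b * nrm (CX (F _ X0 X1)) f.
    move=> [g cg dg]; have fin := cesaro_fin cg.
    have [] := hb _ (lT f fin) (hM0 f fin) (hM1 f fin) _ dg.
    by rewrite (spreadK _ _ cg (proj1 (sumX g dg))) (CX_nrm _ cg).
  split; first by apply/seteqP; split=> f; [case/fwd|case/bwd].
  exists (Num.max a b) => f df; have [dg lg] := fwd f df; have [_ lb] := bwd f dg.
  split.
    apply: le_trans lb _; rewrite ler_wpM2r// ?le_max ?lexx ?orbT//.
    have [g cg dg'] := dg; rewrite (CX_nrm _ cg); exact: nrm_ge0.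
  apply: le_trans lg _; rewrite ler_wpM2r// ?le_max ?lexx//; exact: nrm_ge0.
- have fwd f : dom (Kmethod G (CX X0) (CX X1)) f ->
      dom (CX (Kmethod G X0 X1)) f /\
      nrm (CX (Kmethod G X0 X1)) f <= M * nrm (Kmethod G (CX X0) (CX X1)) f.
    move=> df; have [g cg] := CX_nsum_cesaro i0 i1 df.1.
    have [dg lg] := Kfun_bounded_by m0 m1 n0 n1 M0 (lS f) (bS0 f) (bS1 f) df.1.
    rewrite (signed_average_self cg) in dg lg.
    have [dKg lKg] := Kmethod_le n0 n1 iG M0 dg lg df.
    by rewrite (CX_nrm _ cg); split=> //; exists g.
  have bwd f : dom (CX (Kmethod G X0 X1)) f ->
      dom (Kmethod G (CX X0) (CX X1)) f /\
      nrm (Kmethod G (CX X0) (CX X1)) f <= M * nrm (CX (Kmethod G X0 X1)) f.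
    move=> [g cg dg]; have fin := cesaro_fin cg.
    have [df lf] := Kfun_bounded_by n0 n1 m0 m1 M0 (lT f fin) (hM0 f fin) (hM1 f fin) dg.1.
    rewrite (spreadK _ _ cg dg.1) in df lf; rewrite (CX_nrm _ cg).
    exact: Kmethod_le m0 m1 iG M0 df lf dg.
  split; first by apply/seteqP; split=> f; [case/fwd|case/bwd].
  exists M => f df; have [dg lg] := fwd f df; have [_ lb] := bwd f dg.
  by split.
Qed.
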